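(* Let $(\mathcal V,\otimes,I,[-,-])$ be a Grothendieck cosmos and let $\lambda$ be a regular cardinal such that $\mathcal V$ is a locally $\lambda$-presentable base. The essential image of the fully faithful tensor embedding $$\Theta\colon\mathcal V\longrightarrow[\mathrm{Pres}_\lambda(\mathcal V),\mathcal V],\qquad X\longmapsto(X\otimes-)|_{\mathrm{Pres}_\lambda(\mathcal V)},$$ is precisely $\operatorname{Ess.Im}\Theta=\lambda\text{-}\mathrm{Cocont}(\mathrm{Pres}_\lambda(\mathcal V),\mathcal V)$, that is, the subcategory of $\lambda$-cocontinuous $\mathcal V$-functors from $\mathrm{Pres}_\lambda(\mathcal V)$ to $\mathcal V$. Further, $\Theta_0$ induces an equivalence of exact categories $$(\mathcal V_0,\mathscr E_\otimes)\simeq\lambda\text{-}\mathrm{Cocont}(\mathrm{Pres}_\lambda(\mathcal V),\mathcal V),$$ where the exact structure on the right-hand side is induced by the abelian structure on $[\mathrm{Pres}_\lambda(\mathcal V),\mathcal V]_0$.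
   Context: A Grothendieck cosmos is a closed symmetric monoidal category $(\mathcal V,\otimes,I,[-,-])$ whose underlying ordinary category $\mathcal V_0$ is a (bicomplete) Grothendieck category. $\mathcal V$ is viewed as a $\mathcal V$-category with hom-objects $[X,Y]$. It is a locally $\lambda$-presentable base if (1) $\mathcal V_0$ is locally $\lambda$-presentable, (2) $I$ is $\lambda$-presentable, (3) the class of $\lambda$-presentable objects is closed under $\otimes$. $\mathrm{Pres}_\lambda(\mathcal V)$ is the full $\mathcal V$-subcategory of $\lambda$-presentable objects (those $A$ for which $\mathcal V_0(A,-)\colon\mathcal V_0\to\mathsf{Set}$ preserves $\lambda$-directed colimits); it is essentially small and is treated as small. For a small $\mathcal V$-category $\mathcal A$, $[\mathcal A,\mathcal V]$ is the $\mathcal V$-category of $\mathcal V$-functors $\mathcal A\to\mathcal V$; its underlying ordinary category $[\mathcal A,\mathcal V]_0$ (morphisms: $\mathcal V$-natural transformations) is abelian, with (co)limits computed objectwise. $\Theta_0$ is the ordinary functor underlying $\Theta$. $\operatorname{Ess.Im}\Theta$ is the full subcategory of objects isomorphic in $[\mathrm{Pres}_\lambda(\mathcal V),\mathcal V]_0$ to some $\Theta(X)$. For $\mathcal V$-functors $G\colon\mathcal K^{\mathrm{op}}\to\mathcal V$ and $F\colon\mathcal K\to\mathcal A$, the colimit of $F$ weighted by $G$, if it exists, is an object $G\star F\in\mathcal A$ with an isomorphism $\mathcal A(G\star F,A)\cong[\mathcal K^{\mathrm{op}},\mathcal V](G,\mathcal A(F(-),A))$, $\mathcal V$-natural in $A\in\mathcal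 A$. The weight $G$ is $\lambda$-small if $\operatorname{Ob}\mathcal K$ is a set of cardinality $<\lambda$, all hom-objects of $\mathcal K$ are $\lambda$-presentable in $\mathcal V_0$, and every $G(K)$ is $\lambda$-presentable in $\mathcal V_0$. A $\mathcal V$-functor $T\colon\mathcal A\to\mathcal B$ is $\lambda$-cocontinuous if it preserves all $\lambda$-small weighted colimits, i.e. $G\star(T\circ F)\cong T(G\star F)$ whenever $G$ is a $\lambda$-small weight and $G\star F$ exists; $\lambda\text{-}\mathrm{Cocont}(\mathcal A,\mathcal B)$ is the collection of these. $\mathscr E_\otimes$ is the geometrically pure exact structure on $\mathcal V_0$: all short exact sequences in $\mathcal V_0$ that remain exact under $-\otimes V$ for every $V\in\mathcal V$. The exact structure induced on the (extension-closed) subcategory $\operatorname{Ess.Im}\Theta$ by the abelian structure consists of the sequences in it that are short exact in $[\mathrm{Pres}_\lambda(\mathcal V),\mathcal V]_0$. An equivalence of exact categories is an additive equivalence that preserves and reflects the distinguished short exact sequences. *)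

(* Defs.v *)
(* MathComp, with the classical layer of MathComp-Analysis. *)
From mathcomp Require Import all_boot.
From mathcomp Require Import boolp classical_sets functions cardinality.

Set Implicit Arguments.
Unset Strict Implicit.
Unset Printing Implicit Defensive.
Local Obligation Tactic := idtac.

Local Open Scope classical_set_scope.
Local Open Scope card_scope.

Declare Scope vcat_scope.
Delimit Scope vcat_scope with VC.
Local Open Scope vcat_scope.

(* The fixed universe of small sets.  Objects and morphisms of categories may *)
(* live in larger universes; smallness is always imposed explicitly.          *)
Definition small := Type.

Definition is_small (T : Type) : Prop :=
  exists S : small, [set: T] #<= [set: S].

Definition card_lt (T U : Type) : Prop :=
  ([set: T] #<= [set: U]) /\ ~ ([set: U] #<= [set: T]).

(* A cardinal is represented by a small set L of that cardinality. *)
Definition regular_cardinal (L : small) : Prop :=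
  ([set: nat] #<= [set: L]) /\
  forall (J : small) (T : J -> small),
    card_lt J L -> (forall j, card_lt (T j) L) -> card_lt {j : J & T j} L.

Record category := Category {
  ob :> Type;
  hom : ob -> ob -> Type;
  idm : forall X, hom X X;
  comp : forall X Y Z, hom Y Z -> hom X Y -> hom X Z;
  comp1m : forall X Y (f : hom X Y), comp (idm Y) f = f;
  compm1 : forall X Y (f : hom X Y), comp f (idm X) = f;
  compA : forall W X Y Z (h : hom Y Z) (g : hom X Y) (f : hom W X),
    comp h (comp g f) = comp (comp h g) f }.

Arguments hom {c} X Y.
Arguments idm {c} X.
Arguments comp {c X Y Z} g f.
Notation "g \c f" := (comp g f)
  (at level 40, left associativity) : vcat_scope.

Definition locally_small (C : category) : Prop :=
  forall X Y : C, is_small (hom X Y).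

Definition small_category (C : category) : Prop := is_small C /\ locally_small C.

Definition is_iso (C : category) (X Y : C) (f : hom X Y) : Prop :=
  exists g : hom Y X, g \c f = idm X /\ f \c g = idm Y.

Definition isomorphic (C : category) (X Y : C) : Prop :=
  exists f : hom X Y, is_iso f.

Definition is_mono (C : category) (X Y : C) (f : hom X Y) : Prop :=
  forall (W : C) (g h : hom W X), f \c g = f \c h -> g = h.

Definition is_epi (C : category) (X Y : C) (f : hom X Y) : Prop :=
  forall (Z : C) (g h : hom Y Z), g \c f = h \c f -> g = h.

Record functor (C D : category) := Functor {
  fob :> C -> D;
  fmap : forall X Y, hom X Y -> hom (fob X) (fob Y);
  fmap1 : forall X, fmap (idm X) = idm (fob X);
  fmapM : forall X Y Z (g : hom Y Z) (f : hom X Y),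
    fmap (g \c f) = fmap g \c fmap f }.

Arguments fmap {C D} F {X Y} f : rename.

Definition id_functor (C : category) : functor C C :=
  @Functor C C id (fun _ _ => id) (fun=> erefl) (fun _ _ _ _ _ => erefl).

Program Definition comp_functor (C D E : category)
    (G : functor D E) (F : functor C D) : functor C E :=
  @Functor C E (fun X => G (F X)) (fun X Y f => fmap G (fmap F f)) _ _.
Next Obligation. by move=> *; rewrite /= !fmap1. Qed.
Next Obligation. by move=> *; rewrite /= !fmapM. Qed.

Definition natural (C D : category) (F G : functor C D)
    (a : forall X, hom (F X) (G X)) : Prop :=
  forall X Y (f : hom X Y), a Y \c fmap F f = fmap G f \c a X.

Definition naturally_isomorphic (C D : category) (F G : functor C D) : Prop :=
  exists a : forall X, hom (F X) (G X), natural a /\ forall X, is_iso (a X).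

Definition is_equivalence (C D : category) (F : functor C D) : Prop :=
  exists G : functor D C,
    naturally_isomorphic (comp_functor G F) (id_functor C) /\
    naturally_isomorphic (comp_functor F G) (id_functor D).

Definition full_subcategory (C : category) (P : C -> Prop) : category :=
  @Category {X : C | P X} (fun X Y => hom (sval X) (sval Y))
    (fun X => idm (sval X)) (fun X Y Z g f => g \c f)
    (fun X Y f => comp1m f) (fun X Y f => compm1 f)
    (fun W X Y Z h g f => compA h g f).

Definition corestrict (C D : category) (P : D -> Prop) (F : functor C D)
    (FP : forall X, P (F X)) : functor C (full_subcategory P) :=
  @Functor C (full_subcategory P) (fun X => exist P (F X) (FP X))
    (fun X Y f => fmap F f) (fun X => fmap1 F X)
    (fun X Y Z g f => fmapM F g f).

Definition essential_image (C D : category) (F : functor C D) (Y : D) : Prop :=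
  exists X : C, isomorphic (F X) Y.

Definition is_cocone (J C : category) (D : functor J C) (X : C)
    (i : forall j, hom (D j) X) : Prop :=
  forall j k (u : hom j k), i k \c fmap D u = i j.

Definition is_colimit (J C : category) (D : functor J C) (X : C)
    (i : forall j, hom (D j) X) : Prop :=
  is_cocone i /\
  forall (Y : C) (y : forall j, hom (D j) Y), is_cocone y ->
    exists! h : hom X Y, forall j, h \c i j = y j.

Definition cocomplete (C : category) : Prop :=
  forall (J : category) (D : functor J C), small_category J ->
    exists (X : C) (i : forall j, hom (D j) X), is_colimit i.

Definition filtered (J : category) : Prop :=
  [/\ inhabited J,
      forall j k : J, exists l : J, inhabited (hom j l) /\ inhabited (hom k l) &
      forall (j k : J) (u v : hom j k), exists (l : J) (w : hom k l),
        w \c u = w \c v].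

Record small_poset := SmallPoset {
  elt : small;
  ple : elt -> elt -> Prop;
  ple_refl : forall x, ple x x;
  ple_trans : forall x y z, ple y z -> ple x y -> ple x z;
  ple_anti : forall x y, ple x y -> ple y x -> x = y }.

Definition poset_category (J : small_poset) : category :=
  @Category (elt J) (@ple J) (@ple_refl J) (@ple_trans J)
    (fun _ _ _ => Prop_irrelevance _ _) (fun _ _ _ => Prop_irrelevance _ _)
    (fun _ _ _ _ _ _ _ => Prop_irrelevance _ _).

Definition directed (L : small) (J : small_poset) : Prop :=
  forall A : set (elt J), card_lt {j : elt J | A j} L ->
    exists k, forall j, A j -> ple j k.

(* The image of the cocone i under C(A, -) is a colimit cocone of sets. *)
Definition hom_preserves_colimit (C : category) (A : C) (J : category)
    (D : functor J C) (X : C) (i : forall j, hom (D j) X) : Prop :=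
  forall (T : Type) (t : forall j, hom A (D j) -> T),
    (forall j k (u : hom j k) (x : hom A (D j)), t k (fmap D u \c x) = t j x) ->
    exists! h : hom A X -> T, forall j (x : hom A (D j)), h (i j \c x) = t j x.

Definition presentable (L : small) (C : category) (A : C) : Prop :=
  forall (J : small_poset) (D : functor (poset_category J) C) (X : C)
    (i : forall j, hom (D j) X),
    directed L J -> is_colimit i -> hom_preserves_colimit A i.

Definition locally_presentable (L : small) (C : category) : Prop :=
  cocomplete C /\
  exists (S : small) (P : S -> C), (forall s, presentable L (P s)) /\
    forall X : C, exists (J : small_poset) (D : functor (poset_category J) C)
      (i : forall j, hom (D j) X),
      [/\ directed L J, forall j, exists s, isomorphic (D j) (P s) & is_colimit i].

Definition is_zero_object (C : category) (Z : C) : Prop :=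
  forall X : C, (exists! f : hom X Z, True) /\ (exists! f : hom Z X, True).

Definition is_zero (C : category) (X Y : C) (f : hom X Y) : Prop :=
  exists (Z : C) (p : hom X Z) (q : hom Z Y), is_zero_object Z /\ f = q \c p.

Definition is_product (C : category) (X Y P : C) (p : hom P X) (q : hom P Y) :
    Prop :=
  forall (W : C) (f : hom W X) (g : hom W Y),
    exists! h : hom W P, p \c h = f /\ q \c h = g.

Definition is_coproduct (C : category) (X Y P : C) (i : hom X P) (j : hom Y P) :
    Prop :=
  forall (W : C) (f : hom X W) (g : hom Y W),
    exists! h : hom P W, h \c i = f /\ h \c j = g.

Record is_biproduct (C : category) (X Y P : C) (p : hom P X) (q : hom P Y)
    (i : hom X P) (j : hom Y P) : Prop := {
  biproduct_product : is_product p q;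
  biproduct_coproduct : is_coproduct i j;
  biproduct_pi : p \c i = idm X;
  biproduct_qj : q \c j = idm Y;
  biproduct_pj : is_zero (p \c j);
  biproduct_qi : is_zero (q \c i) }.

Definition is_kernel (C : category) (X Y Z : C) (k : hom X Y) (f : hom Y Z) :
    Prop :=
  is_zero (f \c k) /\
  forall (W : C) (g : hom W Y), is_zero (f \c g) ->
    exists! h : hom W X, k \c h = g.

Definition is_cokernel (C : category) (X Y Z : C) (c : hom Y Z) (f : hom X Y) :
    Prop :=
  is_zero (c \c f) /\
  forall (W : C) (g : hom Y W), is_zero (g \c f) ->
    exists! h : hom Z W, h \c c = g.

(* The additive structure on the hom-sets of an abelian category is not part  *)
(* of the data: it is determined by the biproducts.                           *)
Record abelian (C : category) : Prop := {
  abelian_zero : exists Z : C, is_zero_object Z;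
  abelian_biproduct : forall X Y : C, exists (P : C) (p : hom P X) (q : hom P Y)
    (i : hom X P) (j : hom Y P), is_biproduct p q i j;
  abelian_kernel : forall (X Y : C) (f : hom X Y),
    exists (K : C) (k : hom K X), is_kernel k f;
  abelian_cokernel : forall (X Y : C) (f : hom X Y),
    exists (Q : C) (c : hom Y Q), is_cokernel c f;
  abelian_mono : forall (X Y : C) (f : hom X Y), is_mono f ->
    exists (Z : C) (g : hom Y Z), is_kernel f g;
  abelian_epi : forall (X Y : C) (f : hom X Y), is_epi f ->
    exists (W : C) (g : hom W X), is_cokernel f g }.

Definition short_exact (C : category) (X Y Z : C) (f : hom X Y) (g : hom Y Z) :
    Prop :=
  is_kernel f g /\ is_cokernel g f.

Definition exact_filtered_colimits (C : category) : Prop :=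
  forall (J : category) (D1 D2 D3 : functor J C)
    (a : forall j, hom (D1 j) (D2 j)) (b : forall j, hom (D2 j) (D3 j))
    (X1 X2 X3 : C) (i1 : forall j, hom (D1 j) X1) (i2 : forall j, hom (D2 j) X2)
    (i3 : forall j, hom (D3 j) X3) (f : hom X1 X2) (g : hom X2 X3),
    small_category J -> filtered J -> natural a -> natural b ->
    (forall j, short_exact (a j) (b j)) ->
    is_colimit i1 -> is_colimit i2 -> is_colimit i3 ->
    (forall j, f \c i1 j = i2 j \c a j) -> (forall j, g \c i2 j = i3 j \c b j) ->
    short_exact f g.

Definition is_generator (C : category) (U : C) : Prop :=
  forall (X Y : C) (f g : hom X Y),
    (forall u : hom U X, f \c u = g \c u) -> f = g.

Record grothendieck_category (C : category) : Prop := {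
  grothendieck_locally_small : locally_small C;
  grothendieck_abelian : abelian C;
  grothendieck_cocomplete : cocomplete C;
  grothendieck_exact : exact_filtered_colimits C;
  grothendieck_generator : exists U : C, is_generator U }.

(* An exact category is given by a category together with its distinguished   *)
(* class of short exact sequences.                                            *)
Definition conflations (C : category) :=
  forall X Y Z : C, hom X Y -> hom Y Z -> Prop.

(* Between additive categories, this amounts to additivity on hom-sets. *)
Record additive_functor (C D : category) (F : functor C D) : Prop := {
  additive_zero : forall Z, is_zero_object Z -> is_zero_object (F Z);
  additive_biproduct : forall (X Y P : C) (p : hom P X) (q : hom P Y)
    (i : hom X P) (j : hom Y P), is_biproduct p q i j ->
    is_biproduct (fmap F p) (fmap F q) (fmap F i) (fmap F j) }.

Record exact_equivalence (C D : category) (EC : conflations C)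
    (ED : conflations D) (F : functor C D) : Prop := {
  exact_equivalence_equivalence : is_equivalence F;
  exact_equivalence_additive : additive_functor F;
  exact_equivalence_exact : forall (X Y Z : C) (f : hom X Y) (g : hom Y Z),
    EC X Y Z f g <-> ED (F X) (F Y) (F Z) (fmap F f) (fmap F g) }.

Definition induced_exact_structure (C : category) (P : C -> Prop) :
    conflations (full_subcategory P) :=
  fun X Y Z f g => @short_exact C (sval X) (sval Y) (sval Z) f g.

Record closed_symmetric_monoidal := ClosedSymmetricMonoidal {
  base :> category;
  tens : base -> base -> base;
  tensm : forall X X' Y Y', hom X X' -> hom Y Y' -> hom (tens X Y) (tens X' Y');
  unitob : base;
  assoc : forall X Y Z, hom (tens (tens X Y) Z) (tens X (tens Y Z));
  associ : forall X Y Z, hom (tens X (tens Y Z)) (tens (tens X Y) Z);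
  lunit : forall X, hom (tens unitob X) X;
  luniti : forall X, hom X (tens unitob X);
  runit : forall X, hom (tens X unitob) X;
  runiti : forall X, hom X (tens X unitob);
  braid : forall X Y, hom (tens X Y) (tens Y X);
  ihom : base -> base -> base;
  ev : forall X Y, hom (tens (ihom X Y) X) Y;
  curry : forall X Y Z, hom (tens Z X) Y -> hom Z (ihom X Y);
  tensm1 : forall X Y, tensm (idm X) (idm Y) = idm (tens X Y);
  tensmM : forall X X' X'' Y Y' Y'' (f' : hom X' X'') (f : hom X X')
      (g' : hom Y' Y'') (g : hom Y Y'),
    tensm (f' \c f) (g' \c g) = tensm f' g' \c tensm f g;
  assocK : forall X Y Z, associ X Y Z \c assoc X Y Z = idm _;
  associK : forall X Y Z, assoc X Y Z \c associ X Y Z = idm _;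
  lunitK : forall X, luniti X \c lunit X = idm _;
  lunitiK : forall X, lunit X \c luniti X = idm _;
  runitK : forall X, runiti X \c runit X = idm _;
  runitiK : forall X, runit X \c runiti X = idm _;
  braidK : forall X Y, braid Y X \c braid X Y = idm _;
  assoc_natural : forall X X' Y Y' Z Z' (f : hom X X') (g : hom Y Y')
      (h : hom Z Z'),
    assoc X' Y' Z' \c tensm (tensm f g) h
      = tensm f (tensm g h) \c assoc X Y Z;
  lunit_natural : forall X Y (f : hom X Y),
    lunit Y \c tensm (idm unitob) f = f \c lunit X;
  runit_natural : forall X Y (f : hom X Y),
    runit Y \c tensm f (idm unitob) = f \c runit X;
  braid_natural : forall X X' Y Y' (f : hom X X') (g : hom Y Y'),
    braid X' Y' \c tensm f g = tensm g f \c braid X Y;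
  pentagon : forall W X Y Z,
    tensm (idm W) (assoc X Y Z) \c assoc W (tens X Y) Z
      \c tensm (assoc W X Y) (idm Z)
      = assoc W X (tens Y Z) \c assoc (tens W X) Y Z;
  triangle : forall X Y,
    tensm (idm X) (lunit Y) \c assoc X unitob Y = tensm (runit X) (idm Y);
  hexagon : forall X Y Z,
    assoc Y Z X \c braid X (tens Y Z) \c assoc X Y Z
      = tensm (idm Y) (braid X Z) \c assoc Y X Z \c tensm (braid X Y) (idm Z);
  (* the functor - (x) X is left adjoint to [X, -] *)
  curryK : forall X Y Z (f : hom (tens Z X) Y),
    ev X Y \c tensm (curry f) (idm X) = f;
  curry_unique : forall X Y Z (f : hom Z (ihom X Y)),
    curry (ev X Y \c tensm f (idm X)) = f }.

Arguments tens {c} X Y : rename.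
Arguments tensm {c X X' Y Y'} f g : rename.
Arguments unitob c : rename.
Arguments ihom {c} X Y : rename.
Arguments curry {c X Y Z} f : rename.
Arguments ev {c} X Y : rename.
Arguments assoc {c} X Y Z : rename.
Arguments associ {c} X Y Z : rename.
Arguments lunit {c} X : rename.
Arguments luniti {c} X : rename.
Arguments runit {c} X : rename.
Arguments runiti {c} X : rename.
Arguments braid {c} X Y : rename.

Notation "X \ox Y" := (tens X Y)
  (at level 38, left associativity) : vcat_scope.
Notation "f \tm g" := (tensm f g)
  (at level 38, left associativity) : vcat_scope.

Record grothendieck_cosmos := GrothendieckCosmos {
  cosmos_monoidal :> closed_symmetric_monoidal;
  cosmos_grothendieck : grothendieck_category cosmos_monoidal }.

Record locally_presentable_base (L : small) (V : closed_symmetric_monoidal) :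
    Prop := {
  lpb_locally_presentable : locally_presentable L V;
  lpb_unit : presentable L (unitob V);
  lpb_tens : forall A B : V,
    presentable L A -> presentable L B -> presentable L (A \ox B) }.

Definition geometrically_pure (V : closed_symmetric_monoidal) : conflations V :=
  fun X Y Z f g => short_exact f g /\
    forall W : V, short_exact (f \tm idm W) (g \tm idm W).


Section Monoidal.
Context {V : closed_symmetric_monoidal}.
Implicit Types X Y Z W P Q : V.

Definition uncurry X Y Z (f : hom Z (ihom X Y)) : hom (Z \ox X) Y :=
  ev X Y \c (f \tm idm X).

Lemma uncurryK X Y Z (f : hom (Z \ox X) Y) : uncurry (curry f) = f.
Proof. exact: curryK. Qed.

Lemma uncurry_inj X Y Z (f g : hom Z (ihom X Y)) : uncurry f = uncurry g -> f = g.
Proof. by move=> fg; rewrite -[f]curry_unique -[g]curry_unique; congr curry. Qed.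

Lemma uncurry_comp X Y Z W (f : hom Z (ihom X Y)) (g : hom W Z) :
  uncurry (f \c g) = uncurry f \c (g \tm idm X).
Proof. by rewrite /uncurry -compA -tensmM comp1m. Qed.

Lemma tensm1l X Y Y' Y'' (g : hom Y' Y'') (f : hom Y Y') :
  idm X \tm (g \c f) = (idm X \tm g) \c (idm X \tm f).
Proof. by rewrite -tensmM comp1m. Qed.

Lemma tensm1r X Y Y' Y'' (g : hom Y' Y'') (f : hom Y Y') :
  (g \c f) \tm idm X = (g \tm idm X) \c (f \tm idm X).
Proof. by rewrite -tensmM comp1m. Qed.

Lemma tensm_lr X X' Y Y' (f : hom X X') (g : hom Y Y') :
  f \tm g = (f \tm idm Y') \c (idm X \tm g).
Proof. by rewrite -tensmM comp1m compm1. Qed.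

Lemma tensm_rl X X' Y Y' (f : hom X X') (g : hom Y Y') :
  f \tm g = (idm X' \tm g) \c (f \tm idm Y).
Proof. by rewrite -tensmM comp1m compm1. Qed.

Lemma associ_natural X X' Y Y' Z Z' (f : hom X X') (g : hom Y Y') (h : hom Z Z') :
  associ X' Y' Z' \c (f \tm (g \tm h)) = ((f \tm g) \tm h) \c associ X Y Z.
Proof.
rewrite -[LHS]compm1 -(associK X Y Z) !compA -(compA _ _ (assoc X Y Z)).
by rewrite -assoc_natural !compA assocK comp1m.
Qed.

Lemma tensm_unit_inj X Y (f g : hom X Y) :
  idm (unitob V) \tm f = idm (unitob V) \tm g -> f = g.
Proof.
move=> fg; rewrite -[f]compm1 -[g]compm1 -(lunitiK X) !compA.
by rewrite -!lunit_natural fg.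
Qed.

Lemma assoc_epi X Y Z W (f g : hom (X \ox (Y \ox Z)) W) :
  f \c assoc X Y Z = g \c assoc X Y Z -> f = g.
Proof.
by move=> fg; rewrite -[f]compm1 -[g]compm1 -associK !compA fg.
Qed.

Lemma assoc_mono X Y Z W (f g : hom W ((X \ox Y) \ox Z)) :
  assoc X Y Z \c f = assoc X Y Z \c g -> f = g.
Proof.
by move=> fg; rewrite -[f]comp1m -[g]comp1m -assocK -!compA fg.
Qed.

Lemma lunit_assoc X Y :
  lunit (X \ox Y) \c assoc (unitob V) X Y = lunit X \tm idm Y.
Proof.
apply: tensm_unit_inj.
have E1 : (idm (unitob V) \tm (lunit X \tm idm Y))
    \c assoc (unitob V) (unitob V \ox X) Y
    \c (assoc (unitob V) (unitob V) X \tm idm Y)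
  = assoc (unitob V) X Y \c ((runit (unitob V) \tm idm X) \tm idm Y).
  by rewrite -assoc_natural -compA -tensm1r triangle.
have E2 : (idm (unitob V) \tm (lunit (X \ox Y) \c assoc (unitob V) X Y))
    \c assoc (unitob V) (unitob V \ox X) Y
    \c (assoc (unitob V) (unitob V) X \tm idm Y)
  = assoc (unitob V) X Y \c ((runit (unitob V) \tm idm X) \tm idm Y).
  rewrite tensm1l -!compA (compA _ _ (_ \tm idm Y)) pentagon compA triangle.
  by rewrite assoc_natural tensm1.
have := etrans E2 (esym E1).
move/(congr1 (fun f => f \c (associ (unitob V) (unitob V) X \tm idm Y))).
rewrite -!(compA _ (_ \tm idm Y) (_ \tm idm Y)) -tensm1r associK tensm1 !compm1.
exact: assoc_epi.
Qed.

Lemma tensm_unitr_inj X Y (f g : hom X Y) :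
  f \tm idm (unitob V) = g \tm idm (unitob V) -> f = g.
Proof.
move=> fg; rewrite -[f]compm1 -[g]compm1 -(runitiK X) !compA.
by rewrite -!runit_natural fg.
Qed.

Lemma braid_mono X Y W (f g : hom W (X \ox Y)) :
  braid X Y \c f = braid X Y \c g -> f = g.
Proof.
by move=> fg; rewrite -[f]comp1m -[g]comp1m -(braidK X Y) -!compA fg.
Qed.

Lemma lunit_braid X : lunit X \c braid X (unitob V) = runit X.
Proof.
apply: tensm_unitr_inj; apply: braid_mono.
have := congr1 (fun f => lunit (unitob V \ox X) \c f)
  (hexagon X (unitob V) (unitob V)).
rewrite !compA lunit_assoc lunit_natural -braid_natural -!compA triangle => ->.
by rewrite (compA (lunit _)) lunit_assoc -tensm1r.
Qed.

Lemma runit_braid X : runit X \c braid (unitob V) X = lunit X.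
Proof. by rewrite -lunit_braid -compA braidK compm1. Qed.

Lemma hexagon' X Y Z :
  associ Z X Y \c braid (X \ox Y) Z \c associ X Y Z
  = (braid X Z \tm idm Y) \c associ X Z Y \c (idm X \tm braid Y Z).
Proof.
set a := LHS; set b := RHS.
pose c := assoc X Y Z \c braid Z (X \ox Y) \c assoc Z X Y.
have ca : c \c a = idm _.
  rewrite /c /a -!compA (compA _ (associ _ _ _)) associK comp1m.
  by rewrite (compA (braid _ _)) braidK comp1m associK.
have bc : b \c c = idm _.
  rewrite /b /c hexagon -!compA (compA _ (idm X \tm braid Z Y)) -tensm1l braidK.
  rewrite tensm1 comp1m (compA _ (assoc _ _ _)) assocK comp1m -tensm1r braidK.
  by rewrite tensm1.
by rewrite -[LHS]comp1m -bc -compA ca compm1.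
Qed.

Lemma braid_reverse X Y Z :
  (idm Z \tm braid X Y) \c braid (X \ox Y) Z
  = assoc Z Y X \c (braid Y Z \tm idm X) \c braid X (Y \ox Z) \c assoc X Y Z.
Proof.
rewrite -(compA (assoc Z Y X)) -[in RHS]braid_natural !compA.
have := hexagon X Z Y.
move/(congr1 (fun f => f \c associ X Z Y)).
rewrite -compA associK compm1 => ->.
rewrite -!compA; congr (_ \c _).
have := congr1 (fun f => assoc Z X Y \c f \c assoc X Y Z) (hexagon' X Y Z).
rewrite -!compA assocK compm1 compA associK comp1m => ->.
by rewrite !compA.
Qed.

End Monoidal.

Record vcategory (V : closed_symmetric_monoidal) := VCategory {
  vob :> Type;
  vhom : vob -> vob -> V;
  vid : forall X, hom (unitob V) (vhom X X);
  vcomp : forall X Y Z, hom (vhom Y Z \ox vhom X Y) (vhom X Z);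
  vcomp1l : forall X Y,
    vcomp X Y Y \c (vid Y \tm idm (vhom X Y)) = lunit (vhom X Y);
  vcomp1r : forall X Y,
    vcomp X X Y \c (idm (vhom X Y) \tm vid X) = runit (vhom X Y);
  vcompA : forall W X Y Z,
    vcomp W X Z \c (vcomp X Y Z \tm idm (vhom W X))
      = vcomp W Y Z \c (idm (vhom Y Z) \tm vcomp W X Y) \c assoc _ _ _ }.

Arguments vhom {V A} X Y : rename.
Arguments vid {V A} X : rename.
Arguments vcomp {V A} X Y Z : rename.

Record vfunctor (V : closed_symmetric_monoidal) (A B : vcategory V) := VFunctor {
  vfob :> A -> B;
  vfmap : forall X Y, hom (vhom X Y) (vhom (vfob X) (vfob Y));
  vfmap1 : forall X, vfmap X X \c vid X = vid (vfob X);
  vfmapM : forall X Y Z,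
    vfmap X Z \c vcomp X Y Z
      = vcomp (vfob X) (vfob Y) (vfob Z) \c (vfmap Y Z \tm vfmap X Y) }.

Arguments vfmap {V A B} F X Y : rename.

Section Enriched.
Context {V : closed_symmetric_monoidal}.
Implicit Types A B C : vcategory V.

Program Definition vfunctor_comp A B C (G : vfunctor B C) (F : vfunctor A B) :
    vfunctor A C :=
  @VFunctor V A C (fun X => G (F X))
    (fun X Y => vfmap G (F X) (F Y) \c vfmap F X Y) _ _.
Next Obligation. by move=> * /=; rewrite -compA !vfmap1. Qed.
Next Obligation. by move=> * /=; rewrite -compA vfmapM compA vfmapM -compA tensmM. Qed.

Definition scomp (X Y Z : V) : hom (ihom Y Z \ox ihom X Y) (ihom X Z) :=
  curry (ev Y Z \c (idm (ihom Y Z) \tm ev X Y) \c assoc _ _ _).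

Lemma uncurry_scomp (X Y Z P Q : V) (f : hom P (ihom Y Z)) (g : hom Q (ihom X Y)) :
  uncurry (scomp X Y Z \c (f \tm g))
  = uncurry f \c (idm P \tm uncurry g) \c assoc P Q X.
Proof.
rewrite uncurry_comp uncurryK -!compA assoc_natural !compA; congr (_ \c _).
by rewrite -!compA -!tensmM !comp1m compm1.
Qed.

Program Definition self : vcategory V :=
  @VCategory V V ihom (fun X => curry (lunit X)) scomp _ _ _.
Next Obligation.
move=> X Y; apply: uncurry_inj; rewrite uncurry_scomp uncurryK lunit_natural.
by rewrite -compA lunit_assoc /uncurry tensm1 compm1.
Qed.
Next Obligation.
move=> X Y; apply: uncurry_inj; rewrite uncurry_scomp uncurryK -compA triangle.
by rewrite /uncurry tensm1 compm1.
Qed.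
Next Obligation.
move=> W X Y Z; apply: uncurry_inj.
rewrite uncurry_scomp uncurryK uncurry_comp uncurry_scomp uncurryK.
rewrite /uncurry tensm1 !compm1 !tensm1l -!compA; congr (_ \c _).
rewrite (compA _ _ (_ \tm idm _)) pentagon -tensm1 !compA; congr (_ \c _).
by rewrite -!compA assoc_natural tensm1 comp1m.
Qed.

Program Definition vrepr A (X : A) : vfunctor A self :=
  @VFunctor V A self (vhom X) (fun Y Z => curry (vcomp X Y Z)) _ _.
Next Obligation.
move=> A X Y; apply: uncurry_inj.
by rewrite uncurry_comp !uncurryK vcomp1l.
Qed.
Next Obligation.
move=> A X W Y Z; apply: uncurry_inj.
by rewrite uncurry_comp uncurry_scomp !uncurryK vcompA.
Qed.

Program Definition vop A : vcategory V :=
  @VCategory V A (fun X Y => vhom Y X) vid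
    (fun X Y Z => vcomp Z Y X \c braid _ _) _ _ _.
Next Obligation. by move=> A X Y /=; rewrite -compA braid_natural compA vcomp1r runit_braid. Qed.
Next Obligation. by move=> A X Y /=; rewrite -compA braid_natural compA vcomp1l lunit_braid. Qed.
Next Obligation.
move=> A W X Y Z /=.
rewrite -[LHS]compA braid_natural tensm1l -!compA braid_reverse !compA.
rewrite -[in RHS](compA _ (braid _ _)) braid_natural tensm1r !compA.
by rewrite vcompA.
Qed.

Program Definition vfunctor_op A B (F : vfunctor A B) : vfunctor (vop A) (vop B) :=
  @VFunctor V (vop A) (vop B) F (fun X Y => vfmap F Y X) _ _.
Next Obligation. by move=> A B F X; exact: vfmap1. Qed.
Next Obligation.
move=> A B F X Y Z /=; by rewrite compA vfmapM -!compA braid_natural.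
Qed.

(* The V-functor A(F-, X) : K^op -> V. *)
Definition vrestrict (K A : vcategory V) (F : vfunctor K A) (X : A) :
    vfunctor (vop K) self :=
  vfunctor_comp (@vrepr (vop A) X) (vfunctor_op F).

Definition vfull_subcategory A (P : A -> Prop) : vcategory V :=
  @VCategory V {X : A | P X} (fun X Y => vhom (sval X) (sval Y))
    (fun X => vid (sval X)) (fun X Y Z => vcomp (sval X) (sval Y) (sval Z))
    (fun X Y => vcomp1l (sval X) (sval Y))
    (fun X Y => vcomp1r (sval X) (sval Y))
    (fun W X Y Z => vcompA (sval W) (sval X) (sval Y) (sval Z)).

Definition vfunctor_restrict A B (P : A -> Prop) (F : vfunctor A B) :
    vfunctor (vfull_subcategory P) B :=
  @VFunctor V (vfull_subcategory P) B (fun X => F (sval X))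
    (fun X Y => vfmap F (sval X) (sval Y)) (fun X => vfmap1 F (sval X))
    (fun X Y Z => vfmapM F (sval X) (sval Y) (sval Z)).

Definition ihomm (X X' Y Y' : V) (f : hom X' X) (g : hom Y Y') :
    hom (ihom X Y) (ihom X' Y') :=
  curry (g \c ev X Y \c (idm (ihom X Y) \tm f)).

Lemma uncurry_ihomm (X X' Y Y' Z : V) (f : hom X' X) (g : hom Y Y')
    (h : hom Z (ihom X Y)) :
  uncurry (ihomm f g \c h) = g \c uncurry h \c (idm Z \tm f).
Proof.
by rewrite uncurry_comp uncurryK -!compA -!tensmM !compm1 !comp1m.
Qed.

(* V-naturality of a family of morphisms F A -> G A. *)
Definition vnatural A (F G : vfunctor A self)
    (a : forall X : A, hom (F X : V) (G X)) : Prop :=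
  forall X Y : A,
    ihomm (idm _) (a Y) \c vfmap F X Y = ihomm (a X) (idm _) \c vfmap G X Y.

Record vtransformation A (F G : vfunctor A self) := VTransformation {
  vt :> forall X : A, hom (F X : V) (G X);
  vtP : vnatural vt }.

Lemma vtransformation_eq A (F G : vfunctor A self) (a b : vtransformation F G) :
  (forall X, a X = b X) -> a = b.
Proof.
case: a b => [a aP] [b bP] /= ab.
have {}ab : a = b by exact: functional_extensionality_dep.
by case: b / ab in bP *; congr VTransformation; exact: Prop_irrelevance.
Qed.

Lemma ihomm_comp (X X' X'' Y Y' Y'' : V) (f : hom X' X) (f' : hom X'' X')
    (g : hom Y Y') (g' : hom Y' Y'') :
  ihomm f' g' \c ihomm f g = ihomm (f \c f') (g' \c g).
Proof.
apply: uncurry_inj; rewrite uncurry_ihomm !uncurryK -!compA.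
by rewrite -tensmM comp1m.
Qed.

Lemma vnatural_id A (F : vfunctor A self) : vnatural (fun X => idm (F X : V)).
Proof. by []. Qed.

Lemma vnatural_comp A (F G H : vfunctor A self) (b : vtransformation G H)
    (a : vtransformation F G) : vnatural (fun X => b X \c a X).
Proof.
move=> X Y.
have -> : ihomm (idm (F X : V)) (b Y \c a Y)
    = ihomm (idm _) (b Y) \c ihomm (idm _) (a Y) by rewrite ihomm_comp comp1m.
rewrite -compA vtP compA ihomm_comp.
have -> : ihomm (b X \c a X) (idm (H Y : V))
    = ihomm (a X) (idm _) \c ihomm (b X) (idm _) by rewrite ihomm_comp comp1m.
rewrite -compA -vtP compA ihomm_comp; congr (ihomm _ _ \c _).
  by rewrite compm1 comp1m.
by rewrite compm1 comp1m.
Qed.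

(* The ordinary category [A, V]_0.  A need not be small: then the V-natural    *)
(* transformations may form large sets, which is allowed by category.         *)
Program Definition vfunctor_category A : category :=
  @Category (vfunctor A self) (@vtransformation A)
    (fun F => VTransformation (@vnatural_id A F))
    (fun F G H b a => VTransformation (vnatural_comp b a)) _ _ _.
Next Obligation. by move=> *; apply: vtransformation_eq => X /=; rewrite comp1m. Qed.
Next Obligation. by move=> *; apply: vtransformation_eq => X /=; rewrite compm1. Qed.
Next Obligation. by move=> *; apply: vtransformation_eq => X /=; rewrite compA. Qed.

(* p is V-natural from F to G, with a parameter in E. *)
Definition vwedge A (F G : vfunctor A self) (E : V)
    (p : forall X : A, hom E (ihom (F X : V) (G X))) : Prop :=
  forall X Y : A,
    scomp (F X) (G X) (G Y) \c (vfmap G X Y \tm p X)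
    = scomp (F X) (F Y) (G Y) \c (p Y \tm vfmap F X Y) \c braid (vhom X Y) E.

(* E, with the projections p, is the hom-object [A, V](F, G), that is, the    *)
(* end of the objects [F X, G X].                                             *)
Definition is_vfunctor_hom A (F G : vfunctor A self) (E : V)
    (p : forall X : A, hom E (ihom (F X : V) (G X))) : Prop :=
  vwedge p /\
  forall (E' : V) (p' : forall X : A, hom E' (ihom (F X : V) (G X))),
    vwedge p' -> exists! h : hom E' E, forall X, p X \c h = p' X.

(* The isomorphisms A(C, X) = [K^op, V](G, A(F-, X)), V-natural in X, are     *)
(* given by exhibiting A(C, X) as the hom-object on the right-hand side: the  *)
(* k-th component of the isomorphism is p X k : A(C, X) -> [G k, A(F k, X)],  *)
(* and V-naturality in X is tested on components.                             *)
Definition is_weighted_colimit (K A : vcategory V) (G : vfunctor (vop K) self)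
    (F : vfunctor K A) (C : A)
    (p : forall (X : A) (k : K), hom (vhom C X) (ihom (G k : V) (vhom (F k) X))) :
    Prop :=
  (forall X, @is_vfunctor_hom (vop K) G (vrestrict F X) (vhom C X) (p X)) /\
  forall k, @vnatural A (vrepr C)
    (vfunctor_comp (@vrepr self (G k)) (vrepr (F k))) (fun X => p X k).

(* The unit G k -> A(F k, C): the image of the identity of C. *)
Definition colimit_unit (K A : vcategory V) (G : vfunctor (vop K) self)
    (F : vfunctor K A) (C : A)
    (p : forall (X : A) (k : K), hom (vhom C X) (ihom (G k : V) (vhom (F k) X)))
    (k : K) : hom (G k : V) (vhom (F k) C) :=
  uncurry (p C k \c vid C) \c luniti (G k : V).

Definition small_weight (L : small) (K : vcategory V)
    (G : vfunctor (vop K) self) : Prop :=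
  [/\ card_lt K L, forall k l : K, presentable L (vhom k l) &
      forall k : K, presentable L (G k : V)].

(* T preserves the colimit (C, p): the object T C is a colimit of T F         *)
(* weighted by G, through the comparison induced by T.                        *)
Definition preserves_weighted_colimit (K A B : vcategory V) (T : vfunctor A B)
    (G : vfunctor (vop K) self) (F : vfunctor K A) (C : A)
    (p : forall (X : A) (k : K), hom (vhom C X) (ihom (G k : V) (vhom (F k) X))) :
    Prop :=
  exists q : forall (X : B) (k : K),
      hom (vhom (T C) X) (ihom (G k : V) (vhom (T (F k)) X)),
    is_weighted_colimit (F := vfunctor_comp T F) q /\
    forall k, colimit_unit (F := vfunctor_comp T F) q k
      = vfmap T (F k) C \c colimit_unit p k.

Definition cocontinuous (L : small) A B (T : vfunctor A B) : Prop :=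
  forall (K : vcategory V) (G : vfunctor (vop K) self) (F : vfunctor K A) (C : A)
    (p : forall (X : A) (k : K), hom (vhom C X) (ihom (G k : V) (vhom (F k) X))),
    small_weight L G -> is_weighted_colimit p -> preserves_weighted_colimit T p.

End Enriched.

Section TensorEmbedding.
Context {V : closed_symmetric_monoidal}.
Implicit Types A B P Q X Y : V.

(* X (x) f for f : A (x) P -> Q, with the parameter A moved past X. *)
Definition act X A P Q (f : hom (A \ox P) Q) : hom (A \ox (X \ox P)) (X \ox Q) :=
  braid Q X \c (f \tm idm X) \c associ A P X \c (idm A \tm braid X P).

Lemma act_comp X A B P Q (f : hom (A \ox P) Q) (g : hom B A) :
  act X f \c (g \tm idm (X \ox P)) = act X (f \c (g \tm idm P)).
Proof.
have E : (idm A \tm braid X P) \c (g \tm idm (X \ox P))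
    = (g \tm (idm P \tm idm X)) \c (idm B \tm braid X P).
  by rewrite tensm1 -tensm_rl -tensm_lr.
by rewrite /act -[LHS]compA E compA -[in LHS](compA _ (associ _ _ _)) associ_natural
  tensm1r !compA.
Qed.

Lemma act_lunit X P : act X (lunit P) = lunit (X \ox P).
Proof.
rewrite /act -lunit_assoc -!compA (compA (assoc _ _ _)) associK comp1m.
by rewrite lunit_natural compA braidK comp1m.
Qed.

Lemma associ_pentagon A B P X :
  (assoc A B P \tm idm X) \c associ (A \ox B) P X
  = associ A (B \ox P) X \c (idm A \tm associ B P X) \c assoc A B (P \ox X).
Proof.
have := pentagon A B P X.
move/(congr1 (fun f => associ A (B \ox P) X \c (idm A \tm associ B P X) \c f
   \c associ (A \ox B) P X)).
rewrite -!compA associK compm1 (compA (idm A \tm associ _ _ _)) -tensm1l assocK.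
by rewrite tensm1 comp1m (compA (associ _ _ _) (assoc _ _ _)) assocK comp1m.
Qed.

Lemma act_assoc X A B P Q R (f : hom (A \ox Q) R) (g : hom (B \ox P) Q) :
  act X (f \c (idm A \tm g) \c assoc A B P)
  = act X f \c (idm A \tm act X g) \c assoc A B (X \ox P).
Proof.
rewrite /act !tensm1l !tensm1r -!compA; congr (_ \c (_ \c _)).
rewrite [in RHS](compA (idm A \tm braid _ _)) -tensm1l braidK tensm1 comp1m.
rewrite [in RHS](compA (associ A Q X)) associ_natural -!compA; congr (_ \c _).
by rewrite -assoc_natural tensm1 !compA -associ_pentagon -!compA.
Qed.

Program Definition vtensor X : @vfunctor V self self :=
  @VFunctor V self self (tens X) (fun P Q => curry (act X (ev P Q))) _ _.
Next Obligation.
move=> X P; apply: uncurry_inj; rewrite uncurry_comp !uncurryK act_comp.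
by rewrite -/(uncurry _) uncurryK act_lunit.
Qed.
Next Obligation.
move=> X P Q R; apply: uncurry_inj; rewrite uncurry_comp uncurry_scomp !uncurryK.
by rewrite act_comp -/(uncurry _) uncurryK act_assoc.
Qed.

Definition pres (L : small) : vcategory V :=
  @vfull_subcategory V self (@presentable L V).

Definition tensor_embedding_ob (L : small) X : vfunctor (pres L) self :=
  @vfunctor_restrict V self self (@presentable L V) (vtensor X).

Lemma tensor_embedding_natural L X Y (f : hom X Y) :
  @vnatural V (pres L) (tensor_embedding_ob L X) (tensor_embedding_ob L Y)
    (fun P : pres L => f \tm idm (sval P)).
Proof.
move=> P Q; apply: uncurry_inj; rewrite !uncurry_ihomm !uncurryK /= /act.
rewrite comp1m tensm1 compm1 !compA -braid_natural -!compA -tensm1l braid_natural.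
rewrite tensm1l (compA (associ _ _ _)) associ_natural !compA tensm1.
congr (_ \c _ \c _); rewrite -!compA; congr (_ \c _).
by rewrite -tensm_rl -tensm_lr.
Qed.

(* Ordinary functor underlying the tensor embedding; the action of the latter *)
(* on hom-objects is tensor_embedding_hom.                                     *)
Program Definition tensor_embedding (L : small) :
    functor V (vfunctor_category (pres L)) :=
  @Functor V (vfunctor_category (pres L)) (tensor_embedding_ob L)
    (fun X Y f => VTransformation (tensor_embedding_natural f)) _ _.
Next Obligation.
by move=> L X; apply: vtransformation_eq => P; exact: tensm1.
Qed.
Next Obligation.
by move=> L X Y Z g f; apply: vtransformation_eq => P; exact: tensm1r.
Qed.

(* The tensor embedding on hom-objects, followed by the projection of         *)
(* [Pres V, V](X (x) -, Y (x) -) to its component at P.                       *)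
Definition tensor_embedding_hom X Y P : hom (ihom X Y) (ihom (X \ox P) (Y \ox P)) :=
  curry ((ev X Y \tm idm P) \c associ (ihom X Y) X P).

(* The maps [X, Y] -> [Pres V, V](X (x) -, Y (x) -) are isomorphisms. *)
Definition tensor_embedding_fully_faithful (L : small) : Prop :=
  forall X Y, @is_vfunctor_hom V (pres L) (tensor_embedding_ob L X)
    (tensor_embedding_ob L Y) (ihom X Y)
    (fun P : pres L => tensor_embedding_hom X Y (sval P)).

Definition cocont (L : small) (T : vfunctor_category (pres L)) : Prop :=
  cocontinuous L T.

End TensorEmbedding.

(* Main.v *)
From HB Require Import structures.
From mathcomp Require Import all_boot.
From mathcomp Require Import boolp classical_sets cardinality.
Require Import Defs.

(** For a V-functor T on the presentable objects, transposing T(I, P) along   *)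
(** P = [I, P] gives maps t(P) : P (x) T I -> T P, natural in P over the      *)
(** hom-objects (comparison, comparison_action).  Everything rests on the     *)
(** equivalence of three conditions on T (essential_imageP):                  *)
(**   (1) T is isomorphic to some X (x) -;                                    *)
(**   (2) all t(P) are invertible;                                            *)
(**   (3) T preserves small weighted colimits.                                *)
(**                                                                           *)
(** (1) implies (2) since t(P) is a symmetry when T = X (x) -, and t is       *)
(** natural in T.  Under (2), the t(P), composed with a symmetry, form an     *)
(** isomorphism from T I (x) - to T, which gives (1).  (3) implies (2) since  *)
(** P is the colimit of I weighted by P, a weight with a single object.       *)
(**                                                                           *)
(** (2) implies (3): a small weighted colimit among the presentable objects   *)
(** is given by a universal property against presentable objects only.  Its   *)
(** coend description is a colimit, of size less than lambda, of presentable  *)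
(** objects, so the universal property extends to lambda-directed colimits of *)
(** presentable objects, that is, to all of V (presentable_coend,             *)
(** presentable_weighted_coend).  As a coend in V, it is preserved by         *)
(** - (x) T I, which has a right adjoint, and hence by T (comparison_coend).  *)
(**                                                                           *)
(** The comparison also shows that V-natural transformations, and wedges,     *)
(** out of a tensor functor are determined by their component at I            *)
(** (vwedge_unit_ext), and tensoring with I is fully faithful on V; so the    *)
(** tensor embedding is fully faithful, on hom-sets and on hom-objects.       *)
(** Evaluation at I is inverse to it on the cocontinuous V-functors.  Being   *)
(** an equivalence, it is additive.                                           *)
(**                                                                           *)
(** As for exactness (geometrically_pureP), componentwise kernels and         *)
(** cokernels are kernels and cokernels of V-natural transformations.         *)
(** Conversely, evaluation at P preserves kernels, because it is right        *)
(** adjoint to W |-> W (x) [P, -].  Cokernels in V are preserved by every     *)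
(** tensor functor anyway.  So a sequence whose image is exact stays exact    *)
(** after tensoring with a presentable P, and then with any W, which is a     *)
(** directed colimit of presentable objects, by exactness of such colimits.   *)

Set Implicit Arguments.
Unset Strict Implicit.
Unset Printing Implicit Defensive.

Local Open Scope classical_set_scope.
Local Open Scope card_scope.
Local Open Scope vcat_scope.

(** * Small and directed sets *)

Lemma card_le_surjective (T U : Type) (f : T -> U) :
  (forall u, exists t, f t = u) -> [set: U] #<= [set: T].
Proof.
move=> fsurj; have <- : f @` [set: T] = [set: U].
  by apply/seteqP; split=> // u _; have [t <-] := fsurj u; exists t.
exact: card_image_le.
Qed.

Lemma card_le_lt_trans (T U W : Type) :
  [set: T] #<= [set: U] -> card_lt U W -> card_lt T W.
Proof.
move=> TU [UW WU]; split; first exact: card_le_trans TU UW.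
by move=> WT; apply: WU; exact: card_le_trans WT TU.
Qed.

Lemma card_lt_finite (L : small) (T : finType) :
  [set: nat] #<= [set: L] -> card_lt T L.
Proof.
move=> natL; split; first exact: card_le_trans (countableP _) natL.
move=> /(card_le_trans natL) /card_le_finite natT.
by apply: infinite_nat; apply: natT; exact: finite_finset.
Qed.

Lemma directed_family (L : small) (J : small_poset) (K : Type) (g : K -> elt J) :
  directed L J -> card_lt K L -> exists m, forall k, ple (g k) m.
Proof.
move=> Jdir KL; have [|m gm] := Jdir (range g); last first.
  by exists m => k; apply: gm; exists k.
pose g' k : {j | range g j} := exist _ (g k) (ex_intro2 _ _ k I erefl).
apply: card_le_lt_trans KL; apply: (@card_le_surjective _ _ g').
by move=> [j jg]; have [k _ kj] := jg; exists k; exact: eq_exist.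
Qed.

Lemma directed_pair (L : small) (J : small_poset) :
  [set: nat] #<= [set: L] -> directed L J ->
  forall j k : elt J, exists m, ple j m /\ ple k m.
Proof.
move=> natL Jdir j k.
have [m jkm] := directed_family (fun b : bool => if b then j else k) Jdir
  (card_lt_finite bool natL).
by exists m; split; [exact: (jkm true) | exact: (jkm false)].
Qed.

Lemma poset_category_thin (J : small_poset) (j k : poset_category J) (u v : hom j k) :
  u = v.
Proof. exact: (@Prop_irrelevance (ple j k)). Qed.

Lemma directed_filtered (L : small) (J : small_poset) :
  [set: nat] #<= [set: L] -> directed L J -> filtered (poset_category J).
Proof.
move=> natL Jdir; split.
- have [m _] := directed_family (fun v : void => match v with end : elt J) Jdir
    (card_lt_finite void natL).
  exact: (inhabits m).
- move=> j k; have [m [jm km]] := directed_pair natL Jdir j k.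
  by exists m; split; apply: inhabits.
- by move=> j k u v; exists k, (@idm (poset_category J) k); exact: poset_category_thin.
Qed.

Lemma small_poset_category (J : small_poset) : small_category (poset_category J).
Proof.
by split=> [|j k]; [exists (elt J) | exists (ple j k : small)]; exact: card_lexx.
Qed.

(** * Ordinary categories *)

(** For rewriting inside right-nested composites. *)
Lemma comp_whisker (C : category) (X Y Z : C) (f : hom Y Z) (g : hom X Y) (h : hom X Z) :
  f \c g = h -> forall W (w : hom W X), f \c (g \c w) = h \c w.
Proof. by move=> <- W w; rewrite compA. Qed.

Section Isomorphisms.
Context {C : category}.
Implicit Types X Y Z : C.

Lemma is_iso_id X : is_iso (idm X).
Proof. by exists (idm X); rewrite comp1m. Qed.

Lemma is_iso_comp X Y Z (g : hom Y Z) (f : hom X Y) :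
  is_iso g -> is_iso f -> is_iso (g \c f).
Proof.
move=> [g' [gl gr]] [f' [fl fr]]; exists (f' \c g'); split.
  by rewrite -compA (comp_whisker gl) comp1m.
by rewrite -compA (comp_whisker fr) comp1m.
Qed.

Lemma is_iso_cancel_r X Y Z (g : hom Y Z) (f : hom X Y) :
  is_iso f -> is_iso (g \c f) -> is_iso g.
Proof.
move=> [f' [fl fr]] /is_iso_comp gf_iso.
rewrite -[g]compm1 -fr compA; apply: gf_iso.
by exists f.
Qed.

Lemma iso_mono X Y Z (f : hom Y Z) (g h : hom X Y) :
  is_iso f -> f \c g = f \c h -> g = h.
Proof.
move=> [f' [fl _]] /(congr1 (fun k => f' \c k)).
by rewrite !compA fl !comp1m.
Qed.

Lemma iso_epi X Y Z (f : hom X Y) (g h : hom Y Z) :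
  is_iso f -> g \c f = h \c f -> g = h.
Proof.
move=> [f' [_ fr]] /(congr1 (fun k => k \c f')).
by rewrite -!compA fr !compm1.
Qed.

(** The target Z = X provides a left inverse g; the target Z = Y shows that   *)
(** f g is the identity.                                                      *)
Lemma iso_from_precomposition X Y (f : hom X Y) :
  (forall Z (g : hom X Z), exists! h : hom Y Z, h \c f = g) -> is_iso f.
Proof.
move=> f_univ; have [g [gf _]] := f_univ X (idm X).
exists g; split=> //; have [h [_ h_uniq]] := f_univ Y f.
by rewrite -(h_uniq (f \c g)) ?(h_uniq (idm Y)) ?comp1m // -compA gf compm1.
Qed.

End Isomorphisms.

Section ZeroMorphisms.
Context {C : category}.
Implicit Types X Y Z : C.

Lemma zero_object_to Z : is_zero_object Z -> forall X (f g : hom X Z), f = g.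
Proof. by move=> Zz X f g; have [[h [_ hu]] _] := Zz X; rewrite -(hu f) ?(hu g). Qed.

Lemma zero_object_from Z : is_zero_object Z -> forall X (f g : hom Z X), f = g.
Proof. by move=> Zz X f g; have [_ [h [_ hu]]] := Zz X; rewrite -(hu f) ?(hu g). Qed.

(** A zero object Z0 turns an initial object Z into one: the identity of Z,   *)
(** being unique, factors through Z0.                                         *)
Lemma zero_object_initial Z0 Z :
  is_zero_object Z0 -> (forall X, exists! f : hom Z X, True) -> is_zero_object Z.
Proof.
move=> Z0z Zi X; split=> //.
have [p _] := (Z0z X).1; have [q _] := (Z0z Z).2; have [r _] := (Z0z Z).1.
exists (q \c p); split=> // f _.
have [i [_ iu]] := Zi Z; rewrite -[f]comp1m -(iu (idm Z)) // (iu (q \c r)) //.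
by rewrite -compA; congr (q \c _); exact: zero_object_to.
Qed.

Lemma is_zero_eq X Y (f g : hom X Y) : is_zero f -> is_zero g -> f = g.
Proof.
move=> [Z [p [q [Zz ->]]]] [Z' [p' [q' [Zz' ->]]]].
have [i _] := (Zz Z').2.
rewrite (zero_object_to Zz' p' (i \c p)) compA; congr (_ \c p).
exact: zero_object_from.
Qed.

Lemma is_zero_compl X Y Z (g : hom Y Z) (f : hom X Y) : is_zero f -> is_zero (g \c f).
Proof. by move=> [O [p [q [Oz ->]]]]; exists O, p, (g \c q); rewrite compA. Qed.

Lemma is_zero_compr X Y Z (g : hom Y Z) (f : hom X Y) : is_zero g -> is_zero (g \c f).
Proof. by move=> [O [p [q [Oz ->]]]]; exists O, (p \c f), q; rewrite compA. Qed.

Lemma is_zero_through Z : is_zero_object Z ->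
  forall X Y (f : hom X Y), is_zero f -> exists p : hom X Z, exists q : hom Z Y, f = q \c p.
Proof.
move=> Zz X Y f f0; have [p _] := (Zz X).1; have [q _] := (Zz Y).2.
by exists p, q; apply: (is_zero_eq f0); exists Z, p, q.
Qed.

Lemma zero_object_iso Y Z : is_zero_object Z -> isomorphic Y Z -> is_zero_object Y.
Proof.
move=> Zz [f [g [gf fg]]]; apply: (zero_object_initial Zz) => X.
have [h _] := (Zz X).2; exists (h \c f); split=> // k _.
by rewrite -[k]compm1 -gf compA; congr (_ \c _); exact: zero_object_from.
Qed.

End ZeroMorphisms.

(** * Fully faithful functors *)

Section FullyFaithful.
Context {C D : category} (F : functor C D).
Hypothesis F_faithful : forall X Y (f g : hom X Y), fmap F f = fmap F g -> f = g.
Hypothesis F_full : forall X Y (h : hom (F X) (F Y)), exists f : hom X Y, fmap F f = h.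

Section Reflection.
Variable Z0 : C.
Hypotheses (Z0z : is_zero_object Z0) (FZ0z : is_zero_object (F Z0)).

Lemma fmap_zero X Y (f : hom X Y) : is_zero (fmap F f) <-> is_zero f.
Proof.
split=> [/(is_zero_through FZ0z)[p [q]]|/(is_zero_through Z0z)[p [q ->]]]; last first.
  by exists (F Z0), (fmap F p), (fmap F q); rewrite fmapM.
have [p' <-] := F_full p; have [q' <-] := F_full q.
by rewrite -fmapM => /F_faithful ->; exists Z0, p', q'.
Qed.

Lemma reflect_kernel X Y Z (f : hom X Y) (g : hom Y Z) :
  is_kernel (fmap F f) (fmap F g) -> is_kernel f g.
Proof.
move=> [gf0 f_univ]; split; first by apply/fmap_zero; rewrite fmapM.
move=> W h gh0; have [|k [fk k_uniq]] := f_univ _ (fmap F h).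
  by rewrite -fmapM; apply/fmap_zero.
have [k' k'E] := F_full k; exists k'; split=> [|l fl].
  by apply: F_faithful; rewrite fmapM k'E.
by apply: F_faithful; rewrite k'E; apply: k_uniq; rewrite -fmapM fl.
Qed.

Lemma reflect_cokernel X Y Z (f : hom X Y) (g : hom Y Z) :
  is_cokernel (fmap F g) (fmap F f) -> is_cokernel g f.
Proof.
move=> [gf0 g_univ]; split; first by apply/fmap_zero; rewrite fmapM.
move=> W h hf0; have [|k [kg k_uniq]] := g_univ _ (fmap F h).
  by rewrite -fmapM; apply/fmap_zero.
have [k' k'E] := F_full k; exists k'; split=> [|l lg].
  by apply: F_faithful; rewrite fmapM k'E.
by apply: F_faithful; rewrite k'E; apply: k_uniq; rewrite -fmapM lg.
Qed.

End Reflection.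

Section Equivalence.
Hypothesis F_ess_surj : forall Y : D, exists X : C, isomorphic (F X) Y.

Lemma equivalence_zero_object (Z : C) : is_zero_object Z -> is_zero_object (F Z).
Proof.
move=> Zz Y; have [X [u u_iso]] := F_ess_surj Y; have [v [vu uv]] := u_iso; split.
  have [p _] := (Zz X).1; exists (fmap F p \c v); split=> // f _.
  have [p' p'E] := F_full (f \c u).
  by rewrite -[f]compm1 -uv compA -p'E (zero_object_to Zz p p').
have [q _] := (Zz X).2; exists (u \c fmap F q); split=> // f _.
have [q' q'E] := F_full (v \c f).
by rewrite -[f]comp1m -uv -compA -q'E (zero_object_from Zz q q').
Qed.

Lemma equivalence_zero (X Y : C) (f : hom X Y) : is_zero f -> is_zero (fmap F f).
Proof.
move=> [Z [p [q [Zz ->]]]]; exists (F Z), (fmap F p), (fmap F q).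
by rewrite fmapM; split=> //; exact: equivalence_zero_object.
Qed.

Lemma equivalence_product (X Y P : C) (p : hom P X) (q : hom P Y) :
  is_product p q -> is_product (fmap F p) (fmap F q).
Proof.
move=> pq_univ W f g; have [W' [u u_iso]] := F_ess_surj W; have [v [vu uv]] := u_iso.
have [f' f'E] := F_full (f \c u); have [g' g'E] := F_full (g \c u).
have [h [[ph qh] h_uniq]] := pq_univ W' f' g'; exists (fmap F h \c v); split.
  by rewrite !compA -!fmapM ph qh f'E g'E -!compA uv !compm1.
move=> k [pk qk]; have [k' k'E] := F_full (k \c u).
rewrite (h_uniq k'); first by rewrite k'E -compA uv compm1.
by split; apply: F_faithful; rewrite fmapM k'E compA ?pk ?qk.
Qed.

Lemma equivalence_coproduct (X Y P : C) (i : hom X P) (j : hom Y P) :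
  is_coproduct i j -> is_coproduct (fmap F i) (fmap F j).
Proof.
move=> ij_univ W f g; have [W' [u u_iso]] := F_ess_surj W; have [v [vu uv]] := u_iso.
have [f' f'E] := F_full (v \c f); have [g' g'E] := F_full (v \c g).
have [h [[hi hj] h_uniq]] := ij_univ W' f' g'; exists (u \c fmap F h); split.
  by rewrite -!compA -!fmapM hi hj f'E g'E !compA uv !comp1m.
move=> k [ki kj]; have [k' k'E] := F_full (v \c k).
rewrite (h_uniq k'); first by rewrite k'E compA uv comp1m.
by split; apply: F_faithful; rewrite fmapM k'E -compA ?ki ?kj.
Qed.

(** Zero objects and biproducts are given by universal properties. *)
Lemma equivalence_additive : additive_functor F.
Proof.
split=> [|X Y P p q i j [pq ij pi qj pj0 qi0]]; first exact: equivalence_zero_object.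
split; rewrite -?fmapM ?pi ?qj ?fmap1 //.
- exact: equivalence_product.
- exact: equivalence_coproduct.
- exact: equivalence_zero.
- exact: equivalence_zero.
Qed.

End Equivalence.
End FullyFaithful.

(** * Presentable objects *)

Section Presentable.
Context {C : category} (L : small).

Lemma presentable_iso (A B : C) : isomorphic A B -> presentable L A -> presentable L B.
Proof.
move=> [f [g [gf fg]]] Apres J D X i Jdir i_colim T t t_cocone.
have [|h [hE h_uniq]] := Apres J D X i Jdir i_colim T (fun j x => t j (x \c g)).
  by move=> j k u x; rewrite -compA t_cocone.
exists (fun x => h (x \c f)); split=> [j x|k kE].
  by rewrite -compA hE -compA fg compm1.
apply/funext => x; rewrite (h_uniq (fun y => k (y \c g))).
  by rewrite -compA fg compm1.
by move=> j y; rewrite -compA kE.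
Qed.

Variables (J : small_poset) (D : functor (poset_category J) C) (X : C)
  (i : forall j, hom (D j) X).
Hypotheses (L_inf : [set: nat] #<= [set: L]) (J_directed : directed L J)
  (i_colimit : is_colimit i).

(** Two functions from C(A, X) to Prop agree on the maps that factor through  *)
(** the cocone, and hence are equal: the constant one, and the property of    *)
(** being such a map.                                                         *)
Lemma presentable_factor (A : C) : presentable L A ->
  forall f : hom A X, exists j, exists x : hom A (D j), f = i j \c x.
Proof.
move=> Apres f.
have [|h [_ h_uniq]] := Apres J D X i J_directed i_colimit Prop (fun _ _ => True) => //.
have hT : h = fun=> True by exact: h_uniq.
have hE : h = fun f => exists j, exists x : hom A (D j), f = i j \c x.
  by apply: h_uniq => j x; apply/propext; split=> // _; exists j, x.
by move/(congr1 (fun e => e f)): hE => <-; rewrite hT.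
Qed.

(** The germ of x, that is, the set of all elements of the diagram C(A, D -)  *)
(** that become equal to x further on, is the value at x of a cocone.         *)
Lemma presentable_separated (A : C) : presentable L A ->
  forall j (x y : hom A (D j)), i j \c x = i j \c y ->
  exists k, exists u : ple j k, @fmap _ _ D j k u \c x = @fmap _ _ D j k u \c y.
Proof.
move=> Apres j x y xy.
pose germ j (x : hom A (D j)) k (z : hom A (D k)) := exists m,
  exists u : ple j m, exists v : ple k m,
    @fmap _ _ D j m u \c x = @fmap _ _ D k m v \c z.
have [|h [hE _]] := Apres J D X i J_directed i_colimit
    (forall k, hom A (D k) -> Prop) germ; last first.
  have : germ j x j y.
    rewrite -hE xy hE; exists j, (ple_refl j), (ple_refl j); congr (_ \c _).
  move=> [m [u [v]]]; rewrite (Prop_irrelevance v u) => uxy.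
  by exists m, u.
move=> k l u z; apply: functional_extensionality_dep => n; apply/funext => w.
apply/propext; split=> -[m [v [v' E]]].
  exists m, (ple_trans v u), v'; rewrite -E compA -fmapM; congr (fmap D _ \c _).
have [m' [mm' lm']] := directed_pair L_inf J_directed m l.
exists m', lm', (ple_trans mm' v').
have := congr1 (fun e => @fmap _ _ D m m' mm' \c e) E.
rewrite !compA -!fmapM => E'.
rewrite (Prop_irrelevance (ple_trans mm' v') (@comp (poset_category J) _ _ _ mm' v')) -E'.
by congr (fmap D _ \c _); exact: poset_category_thin.
Qed.

End Presentable.

(** * Coends *)

Definition coequalizes (C : category) (K : Type) (N : K -> C) (R : K -> K -> C)
    (a : forall k l, hom (R k l) (N k)) (b : forall k l, hom (R k l) (N l))
    (Q : C) (c : forall k, hom (N k) Q) : Prop :=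
  forall k l, c k \c a k l = c l \c b k l.

(** For N k = G k (x) F k and R k l = K(l, k) (x) G k (x) F l, and with all   *)
(** targets allowed, this is the coend of G and F, that is, their weighted    *)
(** colimit in V.                                                              *)
Definition is_coend_for (C : category) (target : C -> Prop) (K : Type) (N : K -> C)
    (R : K -> K -> C) (a : forall k l, hom (R k l) (N k))
    (b : forall k l, hom (R k l) (N l)) (Q : C) (c : forall k, hom (N k) Q) : Prop :=
  coequalizes a b c /\
  forall Y (d : forall k, hom (N k) Y), target Y -> coequalizes a b d ->
    exists! h : hom Q Y, forall k, h \c c k = d k.

Notation is_coend := (is_coend_for (fun=> True)).

Lemma coend_iso (C : category) (K : Type) (N N' : K -> C) (R R' : K -> K -> C)
    (a : forall k l, hom (R k l) (N k)) (b : forall k l, hom (R k l) (N l))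
    (a' : forall k l, hom (R' k l) (N' k)) (b' : forall k l, hom (R' k l) (N' l))
    (Q Q' : C) (c : forall k, hom (N k) Q) (c' : forall k, hom (N' k) Q')
    (r : forall k l, hom (R k l) (R' k l)) (n : forall k, hom (N k) (N' k))
    (q : hom Q Q') :
  (forall k l, is_iso (r k l)) -> (forall k, is_iso (n k)) -> is_iso q ->
  (forall k l, a' k l \c r k l = n k \c a k l) ->
  (forall k l, b' k l \c r k l = n l \c b k l) ->
  (forall k, c' k \c n k = q \c c k) ->
  is_coend a b c -> is_coend a' b' c'.
Proof.
move=> r_iso n_iso q_iso arn brn cnq [cab c_univ]; split.
  move=> k l; apply: (iso_epi (r_iso k l)).
  by rewrite -!compA arn brn !compA !cnq -!compA cab.
move=> Y d _ dab; have [|h [hc h_uniq]] := c_univ Y (fun k => d k \c n k) I.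
  by move=> k l; rewrite -!compA -arn -brn !compA dab.
have [q' [q'q qq']] := q_iso; exists (h \c q'); split=> [k|h' h'c].
  by apply: (iso_epi (n_iso k)); rewrite -!compA cnq (comp_whisker q'q) comp1m hc.
apply: (iso_epi q_iso); rewrite -compA q'q compm1; apply: h_uniq => k.
by rewrite -compA -cnq compA h'c.
Qed.

(** The coend is a lambda-small colimit of presentable objects: there are     *)
(** fewer than lambda pairs (k, l).  If Q is presentable and has the universal *)
(** property for presentable targets, it has it for all targets, as these are *)
(** lambda-directed colimits of presentable ones: compatible data into such a *)
(** colimit factors through, and becomes compatible at, some stage.           *)
Lemma presentable_coend (L : small) (C : category) :
  [set: nat] #<= [set: L] -> locally_presentable L C ->
  forall (K : Type) (N : K -> C) (R : K -> K -> C)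
    (a : forall k l, hom (R k l) (N k)) (b : forall k l, hom (R k l) (N l))
    (Q : C) (c : forall k, hom (N k) Q),
  card_lt K L -> (forall k, presentable L (N k)) ->
  (forall k l, presentable L (R k l)) -> presentable L Q ->
  is_coend_for (presentable L (C := C)) a b c -> is_coend a b c.
Proof.
move=> L_inf [_ [S [P [Ppres P_gen]]]] K N R a b Q c KL Npres Rpres Qpres [cab Q_univ].
split=> // Y d _ dab; have [J [D [i [Jdir DP i_colim]]]] := P_gen Y.
have Dpres j : presentable L (D j).
  have [s [f [g [gf fg]]]] := DP j; apply: presentable_iso (Ppres s).
  by exists g, f.
have iD j k (u : ple j k) : i k \c @fmap _ _ D j k u = i j by exact: i_colim.1.
have DD j k l (v : ple k l) (u : ple j k) (w : ple j l) :
    @fmap _ _ D j l w = @fmap _ _ D k l v \c @fmap _ _ D j k u.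
  by rewrite -fmapM; congr fmap; exact: poset_category_thin.
have factor A := presentable_factor Jdir i_colim (A := A).
have separated A := presentable_separated L_inf Jdir i_colim (A := A).
have bound M (g : M -> elt J) := directed_family g Jdir.
have pair := directed_pair L_inf Jdir.
have [h hE] : exists h : hom Q Y, forall k, h \c c k = d k.
  (* All d k factor through one stage j, as there are fewer than lambda k. *)
  have /choice[j0 j0P] k := factor _ (Npres k) (d k).
  have [j jP] := bound _ j0 KL.
  have x_ex k : {x : hom (N k) (D j) | d k = i j \c x}.
    apply: cid; have [x ->] := j0P k; exists (@fmap _ _ D _ _ (jP k) \c x).
    by rewrite compA iD.
  pose x k := sval (x_ex k); have xE k : d k = i j \c x k := svalP (x_ex k).
  (* For each (k, l) the relation holds at some stage; bounding first over l  *)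
  (* and then over k gives a stage n at which all relations hold.             *)
  have xab k l : exists m, exists u : ple j m,
      @fmap _ _ D j m u \c (x k \c a k l) = @fmap _ _ D j m u \c (x l \c b k l).
    by apply: (separated _ (Rpres k l)); rewrite !compA -!xE.
  have /choice[m1 m1P] k : exists m1, forall l, exists m, exists u : ple j m,
      ple m m1 /\
      @fmap _ _ D j m u \c (x k \c a k l) = @fmap _ _ D j m u \c (x l \c b k l).
    have /choice[m mP] := xab k; have [m1 m1P] := bound _ m KL.
    by exists m1 => l; have [u uP] := mP l; exists (m l), u.
  have [m2 m2P] := bound _ m1 KL; have [n [m2n jn]] := pair m2 j.
  have [|h [hE _]] := Q_univ _ (fun k => @fmap _ _ D j n jn \c x k) (Dpres n).
    move=> k l; have [m [u [mm1 E]]] := m1P k l.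
    have mn : ple m n := ple_trans m2n (ple_trans (m2P k) mm1).
    by rewrite (DD _ _ _ mn u jn) -!compA E.
  by exists (i n \c h) => k; rewrite -compA hE compA iD xE.
exists h; split=> // h' h'E.
(* Two solutions factor through one stage j, and agree on N at a later one. *)
have [j1 [y1 E1]] := factor _ Qpres h; have [j2 [y2 E2]] := factor _ Qpres h'.
have [j [j1j j2j]] := pair j1 j2.
have [y yE] : exists y, h = i j \c y.
  by exists (@fmap _ _ D _ _ j1j \c y1); rewrite compA iD.
have [y' y'E] : exists y', h' = i j \c y'.
  by exists (@fmap _ _ D _ _ j2j \c y2); rewrite compA iD.
have yc k : exists m, exists u : ple j m,
    @fmap _ _ D j m u \c (y \c c k) = @fmap _ _ D j m u \c (y' \c c k).
  by apply: (separated _ (Npres k)); rewrite !compA -yE -y'E hE h'E.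
have /choice[m mP] := yc; have [m' m'P] := bound _ m KL.
have [n [m'n jn]] := pair m' j.
pose Dn := @fmap _ _ D j n jn.
have [|e [_ e_uniq]] := Q_univ _ (fun k => Dn \c y \c c k) (Dpres n).
  by move=> k l; rewrite -!compA cab.
have Dyy' : Dn \c y = Dn \c y'.
  rewrite -(e_uniq (Dn \c y)) // -(e_uniq (Dn \c y')) // => k.
  have [u uP] := mP k; have mn := ple_trans m'n (m'P k).
  by rewrite /Dn (DD _ _ _ mn u jn) -!compA uP.
by rewrite yE y'E -(iD _ _ jn) -!compA -/Dn Dyy'.
Qed.

(** * Coherence in a symmetric monoidal category *)

(** The action of A moved past X is tensoring with X after this symmetry      *)
(** (act_swap), a form in which such actions are easy to combine.             *)
HB.lock Definition swap (V : closed_symmetric_monoidal) (A X P : V) :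
    hom (A \ox (X \ox P)) (X \ox (A \ox P)) :=
  assoc X A P \c (braid A X \tm idm P) \c associ A X P.

Section Coherence.
Context {V : closed_symmetric_monoidal}.
Implicit Types A E G K P Q X Y Z : V.

Lemma tensm_iso X X' Y Y' (f : hom X X') (g : hom Y Y') :
  is_iso f -> is_iso g -> is_iso (f \tm g).
Proof.
move=> [f' [fl fr]] [g' [gl gr]]; exists (f' \tm g').
by rewrite -!tensmM fl fr gl gr !tensm1.
Qed.

Lemma assoc_iso X Y Z : is_iso (assoc X Y Z).
Proof. by exists (associ X Y Z); rewrite assocK associK. Qed.

Lemma braid_iso X Y : is_iso (braid X Y).
Proof. by exists (braid Y X); rewrite !braidK. Qed.

Lemma lunit_iso X : is_iso (lunit X).
Proof. by exists (luniti X); rewrite lunitK lunitiK. Qed.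

Lemma runit_iso X : is_iso (runit X).
Proof. by exists (runiti X); rewrite runitK runitiK. Qed.

Lemma runiti_natural X Y (f : hom X Y) :
  (f \tm idm (unitob V)) \c runiti X = runiti Y \c f.
Proof.
apply: (iso_mono (runit_iso Y)).
by rewrite !compA runit_natural runitiK -compA runitiK compm1 comp1m.
Qed.

(** This is lunit_assoc, transported along the symmetry. *)
Lemma runit_assoc X Y :
  runit (X \ox Y) = (idm X \tm runit Y) \c assoc X Y (unitob V).
Proof.
have lE : lunit (X \ox Y) = (lunit X \tm idm Y) \c associ (unitob V) X Y.
  by rewrite -lunit_assoc -compA associK compm1.
rewrite -[LHS]compm1 -(assocK X Y (unitob V)) compA; congr (_ \c _).
rewrite -lunit_braid lE -!compA; have := hexagon' X Y (unitob V).
rewrite -!compA => ->.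
by rewrite !compA -tensm1r lunit_braid -triangle -(compA _ (assoc _ _ _)) associK
  compm1 -tensm1l lunit_braid.
Qed.

(** Conjugating m by the right unit isomorphisms gives f. *)
Lemma tensm_unit_full X Y (m : hom (X \ox unitob V) (Y \ox unitob V)) :
  exists f : hom X Y, f \tm idm (unitob V) = m.
Proof.
exists (runit Y \c m \c runiti X); apply: (iso_mono (runit_iso Y)).
by rewrite runit_natural -!compA runitK compm1.
Qed.

Lemma swapE A X P :
  swap A X P = assoc X A P \c (braid A X \tm idm P) \c associ A X P.
Proof. by rewrite unlock. Qed.

Lemma act_swap X A P Q (f : hom (A \ox P) Q) : act X f = (idm X \tm f) \c swap A X P.
Proof.
rewrite /act braid_natural -!compA; congr (_ \c _).
have := congr1 (fun g => assoc X A P \c g \c (idm A \tm braid X P)) (hexagon' A P X).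
rewrite -!compA (comp_whisker (associK _ _ _)) comp1m => ->.
by rewrite !swapE -tensm1l braidK tensm1 compm1 !compA.
Qed.

Lemma swap_natural A A' X X' P P' (f : hom A A') (g : hom X X') (h : hom P P') :
  swap A' X' P' \c (f \tm (g \tm h)) = (g \tm (f \tm h)) \c swap A X P.
Proof.
rewrite !swapE -!compA associ_natural !compA -assoc_natural -!compA; congr (_ \c _).
by rewrite !compA -!tensmM braid_natural comp1m compm1.
Qed.

(** The hexagon: to move A past E (x) X, move it past E, then past X. *)
Lemma swap_tensor A E X P :
  swap A (E \ox X) P \c (idm A \tm associ E X P)
  = associ E X (A \ox P) \c (idm E \tm swap A X P) \c swap A E (X \ox P).
Proof.
have -> : associ E X (A \ox P) \c (idm E \tm swap A X P)
    = assoc (E \ox X) A P \c (associ E X A \tm idm P) \c associ E (X \ox A) P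
      \c (idm E \tm ((braid A X \tm idm P) \c associ A X P)).
  rewrite !swapE -compA tensm1l; apply: (iso_mono (assoc_iso _ _ _)).
  rewrite !compA associK comp1m -pentagon.
  rewrite -!compA (comp_whisker (g := associ E X A \tm _) (h := idm _)).
    by rewrite comp1m (comp_whisker (associK _ _ _)) comp1m.
  by rewrite -tensm1r associK tensm1.
apply: assoc_epi; rewrite !swapE.
have braidE : braid A (E \ox X) \c assoc A E X
    = associ E X A \c (idm E \tm braid A X) \c assoc E A X \c (braid A E \tm idm X).
  apply: (iso_mono (assoc_iso _ _ _)).
  by rewrite !compA associK comp1m hexagon.
have -> : assoc (E \ox X) A P \c (braid A (E \ox X) \tm idm P) \c associ A (E \ox X) P
      \c (idm A \tm associ E X P) \c assoc A E (X \ox P)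
    = assoc (E \ox X) A P \c ((braid A (E \ox X) \c assoc A E X) \tm idm P)
      \c associ (A \ox E) X P.
  by rewrite tensm1r -!compA associ_pentagon -!compA.
rewrite braidE !tensm1r !tensm1l -!compA; congr (_ \c (_ \c _)).
rewrite assocK compm1 [RHS]compA associ_natural -[RHS]compA; congr (_ \c _).
by rewrite -[in LHS]associ_natural tensm1 !compA -associ_pentagon -!compA.
Qed.

End Coherence.

(** * V-functors as actions of hom-objects *)

(** In terms of this transpose of vfmap, V-functoriality, V-naturality and    *)
(** the wedge condition are equations between arrows of V that involve no     *)
(** internal homs of values.  It is sealed so that reassociating composites   *)
(** does not expand it.                                                       *)
HB.lock Definition vaction (V : closed_symmetric_monoidal) (A : vcategory V)
    (T : vfunctor A self) (P Q : A) : hom (vhom P Q \ox (T P : V)) (T Q : V) :=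
  uncurry (vfmap T P Q).

Section Actions.
Context {V : closed_symmetric_monoidal}.
Implicit Types A B K : vcategory V.
Implicit Types E X Y Z : V.

Lemma vactionE A (T : vfunctor A self) (P Q : A) :
  vaction T P Q = uncurry (vfmap T P Q).
Proof. by rewrite unlock. Qed.

Lemma vaction_id A (T : vfunctor A self) (P : A) :
  vaction T P P \c (vid P \tm idm (T P : V)) = lunit (T P : V).
Proof. by rewrite !vactionE -uncurry_comp vfmap1 uncurryK. Qed.

Lemma vaction_comp A (T : vfunctor A self) (P Q R : A) :
  vaction T P R \c (vcomp P Q R \tm idm (T P : V))
  = vaction T Q R \c (idm (vhom Q R) \tm vaction T P Q) \c assoc _ _ _.
Proof. by rewrite !vactionE -uncurry_comp vfmapM uncurry_scomp. Qed.

Lemma vnaturalP A (F G : vfunctor A self) (a : forall P, hom (F P : V) (G P)) :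
  vnatural a <->
  forall P Q, a Q \c vaction F P Q = vaction G P Q \c (idm (vhom P Q) \tm a P).
Proof.
have E P Q : uncurry (ihomm (idm _) (a Q) \c vfmap F P Q) = a Q \c vaction F P Q.
  by rewrite vactionE uncurry_ihomm tensm1 compm1.
have E' P Q : uncurry (ihomm (a P) (idm _) \c vfmap G P Q)
    = vaction G P Q \c (idm (vhom P Q) \tm a P).
  by rewrite vactionE uncurry_ihomm comp1m.
split=> nat P Q; first by rewrite -E nat E'.
by apply: uncurry_inj; rewrite E E' nat.
Qed.

Lemma vwedgeP A (F G : vfunctor A self) E
    (p : forall P : A, hom E (ihom (F P : V) (G P))) :
  vwedge p <-> forall P Q : A,
    vaction G P Q \c (idm _ \tm uncurry (p P)) \c assoc (vhom P Q) E (F P : V)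
    = uncurry (p Q) \c (idm E \tm vaction F P Q) \c assoc E (vhom P Q) (F P : V)
      \c (braid (vhom P Q) E \tm idm (F P : V)).
Proof.
have E1 P Q : uncurry (scomp (F P) (G P) (G Q) \c (vfmap G P Q \tm p P))
    = vaction G P Q \c (idm _ \tm uncurry (p P)) \c assoc (vhom P Q) E (F P : V).
  by rewrite vactionE; exact: uncurry_scomp.
have E2 P Q : uncurry (scomp (F P) (F Q) (G Q) \c (p Q \tm vfmap F P Q)
      \c braid (vhom P Q) E)
    = uncurry (p Q) \c (idm E \tm vaction F P Q) \c assoc E (vhom P Q) (F P : V)
      \c (braid (vhom P Q) E \tm idm (F P : V)).
  by rewrite vactionE uncurry_comp uncurry_scomp.
split=> wedge P Q; first by rewrite -E1 wedge E2.
by apply: uncurry_inj; rewrite E1 E2 wedge.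
Qed.

Lemma vtransformation_iso A (F G : vfunctor_category A) (a : hom F G) :
  (forall P : A, is_iso (vt a P)) -> is_iso a.
Proof.
move=> a_iso; pose b P := sval (cid (a_iso P)).
have bK P : b P \c vt a P = idm _ by exact: (svalP (cid (a_iso P))).1.
have aK P : vt a P \c b P = idm _ by exact: (svalP (cid (a_iso P))).2.
have b_nat : vnatural (F := G) (G := F) b.
  apply/vnaturalP => P Q; apply: (iso_mono (a_iso Q)).
  have /vnaturalP aN := vtP a.
  by rewrite !compA aK comp1m aN -compA -tensm1l aK tensm1 compm1.
by exists (VTransformation b_nat); split; apply: vtransformation_eq => P /=.
Qed.

(** W (x) A(P, -) is the free V-functor on W at P: evaluation at P is right   *)
(** adjoint to it, and therefore preserves kernels.                            *)
Definition vfree A (P : A) (W : V) : vfunctor A self :=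
  vfunctor_comp (vtensor W) (vrepr P).

Lemma vaction_vfree A (P : A) (W : V) (Q R : A) :
  vaction (vfree P W) Q R = act W (vcomp P Q R).
Proof. by rewrite vactionE uncurry_comp uncurryK act_comp -/(uncurry _) uncurryK. Qed.

Lemma vfree_extend_natural A (T : vfunctor A self) (P : A) (W : V)
    (h : hom W (T P : V)) :
  vnatural (F := vfree P W) (G := T)
    (fun Q => vaction T P Q \c braid (T P : V) (vhom P Q) \c (h \tm idm (vhom P Q))).
Proof.
apply/vnaturalP => Q R; rewrite vaction_vfree /act -!compA.
rewrite (comp_whisker (esym (braid_natural _ _))) -compA (comp_whisker (braidK _ _)).
rewrite comp1m (comp_whisker (esym (tensm_rl _ _))) tensm_lr -!compA.
rewrite -(tensm1 (vhom Q R)) (comp_whisker (esym (associ_natural _ _ _))).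
rewrite (comp_whisker (vaction_comp _ _ _ _)) -!compA.
rewrite (comp_whisker (associK _ _ _)) comp1m.
by rewrite -!tensm1l braid_natural.
Qed.

Definition vfree_extend A (T : vfunctor A self) (P : A) (W : V) (h : hom W (T P : V)) :
    @hom (vfunctor_category A) (vfree P W) T :=
  VTransformation (vfree_extend_natural h).

Definition vfree_unit A (P : A) (W : V) : hom W (vfree P W P : V) :=
  (idm W \tm vid P) \c runiti W.

(** With vfree_extend_comp, the half of the adjunction that makes evaluation  *)
(** at P preserve kernels.                                                    *)
Lemma vfree_extendK A (T : vfunctor A self) (P : A) (W : V) (h : hom W (T P : V)) :
  vt (vfree_extend h) P \c vfree_unit P W = h.
Proof.
rewrite /vfree_unit /= -!compA (comp_whisker (esym (tensm_lr _ _))) tensm_rl -!compA.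
rewrite (comp_whisker (braid_natural _ _)) -compA (comp_whisker (vaction_id _ _)).
by rewrite (comp_whisker (lunit_braid _)) runiti_natural (comp_whisker (runitiK _)) comp1m.
Qed.

Lemma vfree_extend_comp A (T T' : vfunctor A self) (a : vtransformation T T') (P : A)
    (W : V) (h : hom W (T P : V)) :
  @comp (vfunctor_category A) _ _ _ a (vfree_extend h) = vfree_extend (a P \c h).
Proof.
apply: vtransformation_eq => Q /=; have /vnaturalP aN := vtP a.
rewrite tensm1r !compA aN -!compA; congr (_ \c _).
by rewrite [RHS]compA [in RHS]braid_natural -compA.
Qed.

End Actions.

(** * Kernels and cokernels of V-natural transformations *)

Section VFunctorExactness.
Context {V : closed_symmetric_monoidal} (Z0 : V).
Hypothesis Z0z : is_zero_object Z0.
Implicit Types A : vcategory V.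
Implicit Types W X Y Z : V.

Lemma tens_zero_object Z W : is_zero_object Z -> is_zero_object (Z \ox W).
Proof.
move=> Zz; apply: (zero_object_initial Z0z) => X.
have [f [_ f_uniq]] := (Zz (ihom W X)).2; exists (uncurry f); split=> // g _.
by rewrite -[g]uncurryK; congr uncurry; exact: f_uniq.
Qed.

Lemma tens_zero_objectl Z W : is_zero_object Z -> is_zero_object (W \ox Z).
Proof.
move=> /(tens_zero_object W) Zz; apply: (zero_object_iso Zz).
by exists (braid W Z); exact: braid_iso.
Qed.

Lemma is_zero_tensm X Y W (f : hom X Y) : is_zero f -> is_zero (f \tm idm W).
Proof.
move=> [Z [p [q [Zz ->]]]]; exists (Z \ox W), (p \tm idm W), (q \tm idm W).
by rewrite tensm1r; split=> //; exact: tens_zero_object.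
Qed.

Lemma zero_ex X Y : exists f : hom X Y, is_zero f.
Proof.
have [p _] := (Z0z X).1; have [q _] := (Z0z Y).2.
by exists (q \c p), Z0, p, q.
Qed.

Lemma is_zero_uncurry X Y W (f : hom W (ihom X Y)) : is_zero (uncurry f) -> is_zero f.
Proof.
move=> f0; have [g g0] := zero_ex W (ihom X Y).
suff -> : f = g by [].
apply: uncurry_inj; apply: is_zero_eq f0 _.
by apply: is_zero_compl; exact: is_zero_tensm.
Qed.

Lemma is_epi_tensm W X Y (f : hom X Y) : is_epi f -> is_epi (f \tm idm W).
Proof.
move=> f_epi Z g h gh; rewrite -[g]uncurryK -[h]uncurryK; congr uncurry.
by apply: f_epi; apply: uncurry_inj; rewrite !uncurry_comp !uncurryK.
Qed.

Lemma is_epi_tensml W X Y (f : hom X Y) : is_epi f -> is_epi (idm W \tm f).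
Proof.
move=> /(is_epi_tensm (W := W)) f_epi Z g h gh.
apply: (iso_epi (braid_iso Y W)); apply: f_epi.
by rewrite -!compA braid_natural !compA gh.
Qed.

Lemma cokernel_epi X Y Z (f : hom X Y) (g : hom Y Z) : is_cokernel g f -> is_epi g.
Proof.
move=> [gf0 g_univ] W h k hk.
have [|l [_ l_uniq]] := g_univ W (h \c g).
  by rewrite -compA; exact: is_zero_compl.
by rewrite -(l_uniq h) // -(l_uniq k).
Qed.

Lemma kernel_mono X Y Z (f : hom X Y) (g : hom Y Z) : is_kernel f g -> is_mono f.
Proof.
move=> [gf0 f_univ] W h k hk.
have [|l [_ l_uniq]] := f_univ W (f \c h).
  by rewrite compA; exact: is_zero_compr.
by rewrite -(l_uniq h) // -(l_uniq k).
Qed.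

Lemma cokernel_tensm X Y Z W (f : hom X Y) (g : hom Y Z) :
  is_cokernel g f -> is_cokernel (g \tm idm W) (f \tm idm W).
Proof.
move=> [gf0 g_univ]; split; first by rewrite -tensm1r; exact: is_zero_tensm.
move=> U h hf0; have [|k [kg k_uniq]] := g_univ _ (curry h).
  by apply: is_zero_uncurry; rewrite uncurry_comp uncurryK.
exists (uncurry k); split=> [|l lg]; first by rewrite -uncurry_comp kg uncurryK.
rewrite -[l]uncurryK; congr uncurry; apply: k_uniq.
by apply: uncurry_inj; rewrite uncurry_comp !uncurryK.
Qed.

Section Components.
Variable A : vcategory V.

Program Definition vzero : vfunctor_category A :=
  @VFunctor V A self (fun=> Z0)
    (fun P Q => curry (sval (cid (zero_ex (vhom P Q \ox Z0) Z0)))) _ _.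
Next Obligation. by apply: uncurry_inj; exact: (zero_object_to Z0z). Qed.
Next Obligation. by apply: uncurry_inj; exact: (zero_object_to Z0z). Qed.

Lemma vzeroP : is_zero_object vzero.
Proof.
move=> F; split.
  have nat : vnatural (F := F) (G := vzero) (fun P => sval (cid (zero_ex (F P) Z0))).
    by apply/vnaturalP => P Q; exact: (zero_object_to Z0z).
  exists (VTransformation nat); split=> // a _; apply: vtransformation_eq => P.
  exact: (zero_object_to Z0z).
have nat : vnatural (F := vzero) (G := F) (fun P => sval (cid (zero_ex Z0 (F P)))).
  apply/vnaturalP => P Q; apply: zero_object_from.
  exact: tens_zero_objectl.
exists (VTransformation nat); split=> // a _; apply: vtransformation_eq => P.
exact: (zero_object_from Z0z).
Qed.

Lemma is_zero_vtransformation (F G : vfunctor_category A) (a : hom F G) :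
  is_zero a <-> forall P, is_zero (vt a P).
Proof.
split=> [/(is_zero_through vzeroP)[p [q ->]] P|a0].
  by exists Z0, (vt p P), (vt q P).
have [p _] := (vzeroP F).1; have [q _] := (vzeroP G).2.
exists vzero, p, q; split; first exact: vzeroP.
apply: vtransformation_eq => P; apply: is_zero_eq => //.
by exists Z0, (vt p P), (vt q P).
Qed.

(** The componentwise lifts are V-natural because each a Q is monic. *)
Lemma componentwise_kernel (F G H : vfunctor_category A) (a : hom F G) (b : hom G H) :
  (forall P, is_kernel (vt a P) (vt b P)) -> is_kernel a b.
Proof.
move=> ab; split; first by apply/is_zero_vtransformation => P; exact: (ab P).1.
move=> E h /is_zero_vtransformation bh0.
have lift P := cid ((ab P).2 _ (vt h P) (bh0 P)).
pose l P := sval (lift P); have lE P : vt a P \c l P = vt h P := (svalP (lift P)).1.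
have l_nat : vnatural l.
  apply/vnaturalP => P Q; apply: (kernel_mono (ab Q)).
  have /vnaturalP aN := vtP a; have /vnaturalP hN := vtP h.
  by rewrite !compA lE hN aN -compA -tensm1l lE.
exists (VTransformation l_nat); split; first exact: vtransformation_eq.
move=> k kE; apply: vtransformation_eq => P; apply: (svalP (lift P)).2.
by rewrite -kE.
Qed.

(** The componentwise extensions are V-natural because tensoring with         *)
(** A(P, Q) keeps b P epic.                                                   *)
Lemma componentwise_cokernel (F G H : vfunctor_category A) (a : hom F G) (b : hom G H) :
  (forall P, is_cokernel (vt b P) (vt a P)) -> is_cokernel b a.
Proof.
move=> ba; split; first by apply/is_zero_vtransformation => P; exact: (ba P).1.
move=> E h /is_zero_vtransformation ha0.
have ext P := cid ((ba P).2 _ (vt h P) (ha0 P)).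
pose l P := sval (ext P); have lE P : l P \c vt b P = vt h P := (svalP (ext P)).1.
have l_nat : vnatural l.
  apply/vnaturalP => P Q; apply: (is_epi_tensml (W := vhom P Q) (cokernel_epi (ba P))).
  have /vnaturalP bN := vtP b; have /vnaturalP hN := vtP h.
  by rewrite -!compA -bN compA lE hN -tensm1l lE.
exists (VTransformation l_nat); split; first exact: vtransformation_eq.
move=> k kE; apply: vtransformation_eq => P; apply: (svalP (ext P)).2.
by rewrite -kE.
Qed.

(** A map h : W -> G P killed by b P amounts to a map from the free V-functor *)
(** on W at P to G, killed by b, and so lifts.                                *)
Lemma kernel_component (F G H : vfunctor_category A) (a : hom F G) (b : hom G H) :
  is_kernel a b -> forall P, is_kernel (vt a P) (vt b P).
Proof.
move=> ab P; split; first by have /is_zero_vtransformation := ab.1; exact.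
move=> W h bh0; have [|l [al l_uniq]] := ab.2 _ (vfree_extend h).
  apply/is_zero_vtransformation => Q; rewrite vfree_extend_comp.
  by apply: is_zero_compl; exact: is_zero_tensm.
exists (vt l P \c vfree_unit P W); split=> [|k ak].
  have /(congr1 (fun e => vt e P)) /= alP := al.
  by rewrite compA alP vfree_extendK.
by rewrite (l_uniq (vfree_extend k)) ?vfree_extendK // vfree_extend_comp ak.
Qed.

End Components.
End VFunctorExactness.

(** * Comparing a V-functor with a tensor functor *)

Section UnitPoint.
Context {V : closed_symmetric_monoidal}.
Implicit Types P Q X : V.

(** The isomorphism P = [I, P]. *)
Definition unit_point P : hom P (ihom (unitob V) P) := curry (runit P).

Lemma unit_point_iso P : is_iso (unit_point P).
Proof.
exists (ev (unitob V) P \c runiti _); split.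
  by rewrite -compA -runiti_natural compA curryK runitiK.
apply: uncurry_inj; rewrite uncurry_comp uncurryK runit_natural -compA runitK.
by rewrite /uncurry tensm1.
Qed.

Lemma scomp_unit_point P Q :
  unit_point Q \c ev P Q
  = scomp (unitob V) P Q \c (idm (ihom P Q) \tm unit_point P).
Proof.
apply: uncurry_inj; rewrite uncurry_comp uncurry_scomp !uncurryK runit_natural runit_assoc.
by rewrite /uncurry tensm1 compm1 compA.
Qed.

End UnitPoint.

(** The transpose of P = [I, P] -> [T I, T P]; it measures how far T is from  *)
(** being tensoring with T I.                                                 *)
HB.lock Definition comparison (V : closed_symmetric_monoidal) (L : small)
    (I_pres : presentable L (unitob V)) (T : vfunctor (pres (V := V) L) self)
    (P : pres (V := V) L) :
    hom (sval P \ox (T (exist _ (unitob V) I_pres) : V)) (T P : V) :=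
  vaction T (exist _ (unitob V) I_pres) P \c (unit_point (sval P) \tm idm _).

Section Comparison.
Context {V : closed_symmetric_monoidal} (L : small).
Hypothesis I_pres : presentable L (unitob V).

Notation unitP := (exist _ (unitob V) I_pres : pres (V := V) L).
Notation comparison := (comparison I_pres).

Implicit Types T : vfunctor (pres (V := V) L) self.
Implicit Types P Q : pres (V := V) L.

Lemma comparisonE T P :
  comparison T P = vaction T unitP P \c (unit_point (sval P) \tm idm _).
Proof. by rewrite unlock. Qed.

(** V-naturality of the comparison in P, with parameters in A: this is        *)
(** functoriality of T on the composites I -> P -> Q.                         *)
Lemma comparison_action T P Q (A : V) (f : hom A (ihom (sval P) (sval Q))) :
  vaction T P Q \c (f \tm comparison T P)
  = comparison T Q \c (uncurry f \tm idm _) \c associ A (sval P) (T unitP : V).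
Proof.
rewrite /uncurry tensm1r -!compA -associ_natural !compA tensm1 tensm_rl compA.
congr (_ \c _); rewrite !comparisonE -[in RHS](compA (vaction _ _ _)) -tensm1r.
rewrite scomp_unit_point tensm1r compA (vaction_comp T unitP P Q).
rewrite tensm1l -!compA; congr (_ \c (_ \c _)).
by rewrite -associ_natural (comp_whisker (associK _ _ _)) comp1m.
Qed.

Lemma comparison_natural T T' (a : vtransformation T T') P :
  a P \c comparison T P = comparison T' P \c (idm (sval P) \tm a unitP).
Proof.
have /vnaturalP aN := vtP a.
rewrite !comparisonE compA aN -!compA; congr (_ \c _).
by rewrite -!tensmM !comp1m !compm1.
Qed.

Lemma comparison_tensor (X : V) P :
  comparison (tensor_embedding_ob L X) P
  = braid (sval P) X \c (idm (sval P) \tm runit X).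
Proof.
rewrite comparisonE vactionE uncurryK.
have -> : act X (ev (unitob V) (sval P)) \c (unit_point (sval P) \tm idm (X \ox unitob V))
    = act X (runit (sval P)).
  by rewrite act_comp /unit_point curryK.
rewrite /act -triangle -!compA (comp_whisker (associK _ _ _)) comp1m.
by rewrite -tensm1l lunit_braid.
Qed.

Lemma comparison_tensor_iso (X : V) P : is_iso (comparison (tensor_embedding_ob L X) P).
Proof.
rewrite comparison_tensor; apply: is_iso_comp; first exact: braid_iso.
by apply: tensm_iso; [exact: is_iso_id | exact: runit_iso].
Qed.

(** Precomposing the wedge condition at (I, P) with P = [I, P] expresses the  *)
(** component at P through the component at I.                                *)
Lemma vwedge_unit_ext (F G : vfunctor (pres (V := V) L) self) (E : V)
    (p q : forall P, hom E (ihom (F P : V) (G P))) :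
  (forall P, is_iso (comparison F P)) -> vwedge p -> vwedge q ->
  p unitP = q unitP -> forall P, p P = q P.
Proof.
move=> F_iso; have at_unit r : vwedge r -> forall P : pres L,
    uncurry (r P) \c (idm E \tm comparison F P) \c assoc E (sval P) (F unitP)
      \c (braid (sval P) E \tm idm (F unitP : V))
    = comparison G P \c (idm (sval P) \tm uncurry (r unitP)) \c assoc (sval P) E (F unitP).
  move=> /vwedgeP r_wedge P.
  have := congr1 (fun e => e \c ((unit_point (sval P) \tm idm E) \tm idm (F unitP : V)))
    (r_wedge unitP P).
  move: (uncurry (r P)) (uncurry (r unitP)) => rP rI.
  rewrite -!compA assoc_natural tensm1 -(tensm1r _ (braid _ _)) braid_natural tensm1r.
  rewrite (comp_whisker (assoc_natural _ _ _)) !comparisonE tensm1l -!compA => <-.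
  by rewrite (comp_whisker (esym (tensm_lr _ _))) (comp_whisker (esym (tensm_rl _ _))).
move=> p_wedge q_wedge pq P; apply: uncurry_inj.
apply: (iso_epi (f := (idm E \tm comparison F P) \c assoc E (sval P) (F unitP)
  \c (braid (sval P) E \tm idm (F unitP : V)))); last first.
  by rewrite !compA (at_unit p) // pq -(at_unit q).
apply: is_iso_comp; last by apply: tensm_iso; [exact: braid_iso | exact: is_iso_id].
apply: is_iso_comp; last exact: assoc_iso.
by apply: tensm_iso; [exact: is_iso_id | exact: F_iso].
Qed.

(** The analogue of vwedge_unit_ext without a parameter. *)
Lemma vtransformation_unit_ext T T' (a b : vtransformation T T') :
  (forall P, is_iso (comparison T P)) -> a unitP = b unitP -> a = b.
Proof.
move=> T_iso ab; apply: vtransformation_eq => P.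
by apply: (iso_epi (T_iso P)); rewrite !comparison_natural ab.
Qed.

Lemma tensor_embedding_faithful (X Y : V) (f g : hom X Y) :
  fmap (tensor_embedding L) f = fmap (tensor_embedding L) g -> f = g.
Proof.
move=> /(congr1 (fun e => vt e unitP)) /=; exact: tensm_unitr_inj.
Qed.

Lemma tensor_embedding_full (X Y : V)
    (a : hom (tensor_embedding (V := V) L X) (tensor_embedding L Y)) :
  exists f : hom X Y, fmap (tensor_embedding L) f = a.
Proof.
have [f fE] := tensm_unit_full (vt a unitP); exists f.
by apply: vtransformation_unit_ext => // P; exact: comparison_tensor_iso.
Qed.

(** [X, Y] acts on the factor X and [P, Q] on the factor P of X (x) P, so the *)
(** two actions commute; formally, [P, Q] is moved past E (x) X.              *)
Lemma tensor_embedding_hom_wedge (X Y : V) (E : V) (h : hom E (ihom X Y)) :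
  vwedge (F := tensor_embedding_ob L X) (G := tensor_embedding_ob L Y)
    (fun P => tensor_embedding_hom X Y (sval P) \c h).
Proof.
apply/vwedgeP => P Q.
have homE R : uncurry (tensor_embedding_hom X Y R \c h)
    = (uncurry h \tm idm R) \c associ E X R.
  by rewrite uncurry_comp uncurryK /uncurry tensm1r -!compA -associ_natural tensm1.
rewrite !homE !vactionE !uncurryK /= !act_swap.
move: (uncurry h) (ev (sval P) (sval Q)) => k e.
rewrite tensm1l -!compA (comp_whisker (swap_natural _ _ _)) -compA.
rewrite (comp_whisker (swap_tensor _ _ _ _)) [swap _ E _]swapE.
rewrite -!compA assocK compm1 tensm1 (comp_whisker (esym (tensm_rl _ _))).
rewrite tensm1l -[in RHS]compA [in RHS](comp_whisker (associ_natural _ _ _)).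
by rewrite tensm1 -!compA [in RHS](comp_whisker (esym (tensm_lr _ _))).
Qed.

Lemma tensor_embedding_is_fully_faithful : tensor_embedding_fully_faithful (V := V) L.
Proof.
move=> X Y.
have wedge (E : V) h := @tensor_embedding_hom_wedge X Y E h.
split=> [|E p p_wedge].
  move=> P Q; have := wedge _ (idm (ihom X Y)) P Q.
  by rewrite !compm1.
have [m mE] := tensm_unit_full (uncurry (p unitP) \c assoc E X (unitob V)).
have homE (h : hom E (ihom X Y)) : uncurry (tensor_embedding_hom X Y (unitob V) \c h)
    = (uncurry h \tm idm (unitob V)) \c associ E X (unitob V).
  by rewrite uncurry_comp uncurryK /uncurry tensm1r -!compA -associ_natural tensm1.
have TX_iso := comparison_tensor_iso X.
exists (curry m); split=> [P|h hE].
  apply: (vwedge_unit_ext TX_iso (wedge _ (curry m)) p_wedge) => /=.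
  by apply: uncurry_inj; rewrite homE uncurryK mE -compA associK compm1.
apply: uncurry_inj; rewrite uncurryK; apply: tensm_unitr_inj; rewrite mE.
by rewrite -hE homE -compA assocK compm1.
Qed.

End Comparison.

(** * Weighted colimits and coends *)

Section WeightedMap.
Context {V : closed_symmetric_monoidal} {A : vcategory V}.
Context {f C : A} {g : V}.

(** The map induced by composition with the unit e of a weighted colimit. *)
Definition weighted_map (e : hom g (vhom f C)) (X : A) :
    hom (vhom C X) (ihom g (vhom f X)) :=
  curry (vcomp f C X \c (idm _ \tm e)).

Lemma uncurry_weighted_map (e : hom g (vhom f C)) (X : A) (E : V) (h : hom E (vhom C X)) :
  uncurry (weighted_map e X \c h) = vcomp f C X \c (h \tm e).
Proof. by rewrite uncurry_comp uncurryK -compA -tensm_rl. Qed.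

Lemma weighted_map_natural (e : hom g (vhom f C)) :
  vnatural (F := vrepr C) (G := vfunctor_comp (@vrepr V self g) (vrepr f))
    (weighted_map e).
Proof.
apply/vnaturalP => X Y; rewrite !vactionE /= uncurry_comp !uncurryK.
apply: uncurry_inj; rewrite uncurry_weighted_map -compA -tensm_lr.
by rewrite uncurry_scomp !uncurryK tensm1l -!compA -assoc_natural tensm1 !compA
  -vcompA -!compA -tensm_lr.
Qed.

(** The Yoneda lemma for A(C, -): evaluate naturality at the identity of C. *)
Lemma weighted_map_yoneda (p : forall X, hom (vhom C X) (ihom g (vhom f X))) :
  vnatural (F := vrepr C) (G := vfunctor_comp (@vrepr V self g) (vrepr f)) p ->
  forall X, p X = weighted_map (uncurry (p C \c vid C) \c luniti g) X.
Proof.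
move=> /vnaturalP p_nat X.
have pE : uncurry (p X) \c (idm _ \tm lunit g)
    = vcomp f C X \c (idm _ \tm uncurry (p C \c vid C)).
  apply: assoc_epi; have := p_nat C X; rewrite !vactionE /= uncurry_comp !uncurryK.
  move/(congr1 (fun e => uncurry (e \c (idm _ \tm vid C)))).
  rewrite -!compA vcomp1r -tensm1l -tensm_lr uncurry_comp uncurry_scomp uncurryK.
  by rewrite triangle !compA.
apply: uncurry_inj; rewrite uncurryK tensm1l [RHS]compA -pE -compA -tensm1l lunitiK.
by rewrite tensm1 compm1.
Qed.

End WeightedMap.

Lemma weighted_map_unit (V : closed_symmetric_monoidal) (K A : vcategory V)
    (G : vfunctor (vop K) self) (F : vfunctor K A) (C : A)
    (e : forall k, hom (G k : V) (vhom (F k) C)) (k : K) :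
  colimit_unit (F := F) (G := G) (fun X k => weighted_map (e k) X) k = e k.
Proof.
rewrite /colimit_unit uncurry_weighted_map tensm_lr compA vcomp1l.
by rewrite lunit_natural -compA lunitiK compm1.
Qed.

(** The two maps K(l, k) (x) G k (x) Z l -> G k (x) Z k, G l (x) Z l whose    *)
(** joint coequalizer is the coend of G and Z.                                *)
HB.lock Definition coend_left (V : closed_symmetric_monoidal) (K : vcategory V)
    (G : vfunctor (vop K) self) (Z : vfunctor K self) (k l : K) :
    hom ((vhom l k \ox (G k : V)) \ox (Z l : V)) ((G k : V) \ox (Z k : V)) :=
  (idm _ \tm vaction Z l k) \c assoc _ _ _ \c (braid (vhom l k) (G k) \tm idm _).

HB.lock Definition coend_right (V : closed_symmetric_monoidal) (K : vcategory V)
    (G : vfunctor (vop K) self) (Z : vfunctor K self) (k l : K) :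
    hom ((vhom l k \ox (G k : V)) \ox (Z l : V)) ((G l : V) \ox (Z l : V)) :=
  vaction G k l \tm idm _.

Section Coends.
Context {V : closed_symmetric_monoidal} {K : vcategory V}.
Implicit Types (G : vfunctor (vop K) self) (Z : vfunctor K self) (k l : K).
Implicit Types E C Y : V.

Lemma coend_leftE G Z k l : coend_left G Z k l =
  (idm _ \tm vaction Z l k) \c assoc _ _ _ \c (braid (vhom l k) (G k) \tm idm _).
Proof. by rewrite unlock. Qed.

Lemma coend_rightE G Z k l : coend_right G Z k l = vaction G k l \tm idm _.
Proof. by rewrite unlock. Qed.

(** A wedge into [G k, [Z k, Y]] with its two arguments collected: a family   *)
(** out of the objects G k (x) Z k with parameter E.                          *)
Definition uncurry_wedge G Z E Y (p : forall k, hom E (ihom (G k : V) (ihom (Z k : V) Y))) k :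
    hom (E \ox ((G k : V) \ox (Z k : V))) Y :=
  uncurry (uncurry (p k)) \c associ E (G k) (Z k).

(** Reordering the tensor factors E, K(l, k), G k, Z l turns the condition on *)
(** a wedge with parameter E into the cocone condition with parameter E.      *)
Lemma vwedge_coequalizes G Z E Y
    (p : forall k, hom E (ihom (G k : V) (ihom (Z k : V) Y))) :
  vwedge (A := vop K) (F := G) (G := vrestrict Z Y) p <->
  coequalizes (fun k l => idm E \tm coend_left G Z k l)
    (fun k l => idm E \tm coend_right G Z k l) (uncurry_wedge p).
Proof.
(* The common reordering of the factors of K(l, k), E, G k, Z l. *)
pose theta k l := assoc E (vhom l k \ox (G k : V)) (Z l)
  \c ((assoc E (vhom l k) (G k) \c (braid (vhom l k) E \tm idm _)) \tm idm (Z l : V)).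
have theta_iso k l : is_iso (theta k l).
  apply: is_iso_comp; first exact: assoc_iso.
  apply: tensm_iso; last exact: is_iso_id.
  apply: is_iso_comp; first exact: assoc_iso.
  by apply: tensm_iso; [exact: braid_iso | exact: is_iso_id].
have left k l : uncurry (vaction (vrestrict Z Y) k l \c (idm _ \tm uncurry (p k))
      \c assoc (vhom l k) E (G k))
    = uncurry_wedge p k \c (idm E \tm coend_left G Z k l) \c theta k l.
  have -> : vaction (vrestrict Z Y) k l \c (idm _ \tm uncurry (p k))
      = scomp (Z l) (Z k) Y \c (uncurry (p k) \tm vfmap Z l k) \c braid (vhom l k) _.
    by rewrite vactionE /= uncurry_comp uncurryK /= -!compA -tensm_lr braid_natural.
  rewrite -[scomp _ _ _ \c _ \c _ \c _]compA uncurry_comp uncurry_scomp -vactionE.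
  rewrite /uncurry_wedge; move: (uncurry (uncurry (p k))) => u.
  rewrite -!compA; congr (u \c _); rewrite coend_leftE.
  apply: (iso_mono (assoc_iso _ _ _)); rewrite (comp_whisker (associK _ _ _)) comp1m.
  rewrite -[idm (tens _ _)]tensm1 (comp_whisker (assoc_natural _ _ _)) -!compA.
  rewrite (comp_whisker (esym (pentagon _ _ _ _))) !tensm1l -!compA.
  congr (_ \c (_ \c _)); rewrite /theta (comp_whisker (esym (assoc_natural _ _ _))).
  by rewrite -!compA -!tensm1r !compA hexagon.
have right k l : uncurry (uncurry (p l) \c (idm E \tm vaction G k l)
      \c assoc E (vhom l k) (G k) \c (braid (vhom l k) E \tm idm (G k : V)))
    = uncurry_wedge p l \c (idm E \tm coend_right G Z k l) \c theta k l.
  rewrite /uncurry_wedge; move: (uncurry (p l)) => q.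
  rewrite !uncurry_comp; move: (uncurry q) => u.
  rewrite -!compA; congr (u \c _); rewrite coend_rightE (comp_whisker (associ_natural _ _ _)).
  rewrite /theta -!compA (comp_whisker (assocK _ _ _)) comp1m.
  by rewrite -!tensm1r.
split=> [/vwedgeP wedge k l|coeq]; last first.
  by apply/vwedgeP => k l; apply: uncurry_inj; rewrite left right coeq.
by apply: (iso_epi (theta_iso k l)); rewrite -left -right wedge.
Qed.

(** Tensoring has a right adjoint, hence preserves coends. *)
Lemma tensm_coend (N : K -> V) (R : K -> K -> V) (a : forall k l, hom (R k l) (N k))
    (b : forall k l, hom (R k l) (N l)) C (c : forall k, hom (N k) C) (W : V) :
  is_coend a b c ->
  is_coend (fun k l => a k l \tm idm W) (fun k l => b k l \tm idm W)
    (fun k => c k \tm idm W).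
Proof.
move=> [cab c_univ]; split=> [k l|Y d _ dab]; first by rewrite -!tensm1r cab.
have [|h [hc h_uniq]] := c_univ (ihom W Y) (fun k => curry (d k)) I.
  by move=> k l; apply: uncurry_inj; rewrite !uncurry_comp !uncurryK dab.
exists (uncurry h); split=> [k|h' h'c]; first by rewrite -uncurry_comp hc uncurryK.
rewrite -[h']uncurryK; congr uncurry; apply: h_uniq => k.
by apply: uncurry_inj; rewrite uncurry_comp !uncurryK.
Qed.

Lemma tensml_coend (N : K -> V) (R : K -> K -> V) (a : forall k l, hom (R k l) (N k))
    (b : forall k l, hom (R k l) (N l)) C (c : forall k, hom (N k) C) (W : V) :
  is_coend a b c ->
  is_coend (fun k l => idm W \tm a k l) (fun k l => idm W \tm b k l)
    (fun k => idm W \tm c k).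
Proof.
move=> /(tensm_coend W) cW.
apply: coend_iso cW; [by move=> *; exact: braid_iso | by move=> *; exact: braid_iso
  | exact: braid_iso | | |] => *; by rewrite braid_natural.
Qed.

Lemma uncurry_wedge_weighted_map G Z C (e : forall k, hom (G k : V) (ihom (Z k : V) C))
    X E (h : hom E (ihom C X)) k :
  uncurry_wedge (fun k => @weighted_map V self (Z k) C (G k) (e k) X \c h) k
  = uncurry h \c (idm E \tm uncurry (e k)).
Proof.
rewrite /uncurry_wedge (uncurry_weighted_map (A := self)) uncurry_scomp -!compA.
by rewrite associK compm1.
Qed.

Lemma uncurry_wedge_inj G Z E Y (p q : forall k, hom E (ihom (G k : V) (ihom (Z k : V) Y))) k :
  uncurry_wedge p k = uncurry_wedge q k -> p k = q k.
Proof.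
move=> pq; apply: uncurry_inj; apply: uncurry_inj; apply: iso_epi pq.
by exists (assoc E (G k) (Z k)); rewrite assocK associK.
Qed.

Lemma uncurry_wedge_comp G Z E E' Y (p : forall k, hom E (ihom (G k : V) (ihom (Z k : V) Y)))
    (h : hom E' E) k :
  uncurry_wedge (fun k => p k \c h) k = uncurry_wedge p k \c (h \tm idm _).
Proof.
rewrite /uncurry_wedge !uncurry_comp; move: (uncurry (uncurry (p k))) => u.
by rewrite -!compA -associ_natural tensm1.
Qed.

Lemma coequalizes_precomp (N : K -> V) (R : K -> K -> V) (a : forall k l, hom (R k l) (N k))
    (b : forall k l, hom (R k l) (N l)) E E' Y (h : hom E' E) (d : forall k, hom (E \ox N k) Y) :
  coequalizes (fun k l => idm E \tm a k l) (fun k l => idm E \tm b k l) d ->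
  coequalizes (fun k l => idm E' \tm a k l) (fun k l => idm E' \tm b k l)
    (fun k => d k \c (h \tm idm (N k))).
Proof.
by move=> dab k l; rewrite -!compA -!tensm_lr (tensm_rl h (a k l)) (tensm_rl h (b k l))
  !compA dab.
Qed.

(** The parameter E of a wedge is absorbed by tensoring the coend with E. *)
Lemma coend_weighted_colimit G Z C (e : forall k, hom (G k : V) (ihom (Z k : V) C)) :
  is_coend (coend_left G Z) (coend_right G Z) (fun k => uncurry (e k)) ->
  is_weighted_colimit (A := self) (F := Z) (C := C) (fun X k => weighted_map (e k) X).
Proof.
move=> e_coend; split=> [X|k]; last exact: weighted_map_natural.
split=> [|E p' /vwedge_coequalizes p'_wedge].
  apply/vwedge_coequalizes => k l.
  have uncurryE j : uncurry_wedge (fun k => @weighted_map V self (Z k) C (G k) (e k) X) j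
      = ev C X \c (idm _ \tm uncurry (e j)).
    have := uncurry_wedge_weighted_map e (idm (ihom C X)) j.
    by rewrite /uncurry_wedge compm1 {3}/uncurry tensm1 compm1.
  by rewrite !uncurryE -!compA -!tensm1l e_coend.1.
have [m [mE m_uniq]] := (tensml_coend E e_coend).2 X _ I p'_wedge.
exists (curry m); split=> [k|h hE].
  pose p k := @weighted_map V self (Z k) C (G k) (e k) X \c curry m.
  apply: (uncurry_wedge_inj (p := p)).
  by rewrite uncurry_wedge_weighted_map uncurryK mE.
apply: uncurry_inj; rewrite uncurryK; apply: m_uniq => k.
by rewrite -uncurry_wedge_weighted_map /uncurry_wedge hE.
Qed.

(** Conversely, testing the enriched universal property on the parameter I    *)
(** gives the ordinary one.                                                    *)
Lemma vfunctor_hom_coend G Z (target : V -> Prop) C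
    (e : forall k, hom (G k : V) (ihom (Z k : V) C)) :
  target C ->
  (forall X, target X -> @is_vfunctor_hom V (vop K) G (vrestrict Z X) (ihom C X)
    (fun k => @weighted_map V self (Z k) C (G k) (e k) X)) ->
  is_coend_for target (coend_left G Z) (coend_right G Z) (fun k => uncurry (e k)).
Proof.
move=> target_C e_univ.
(* An abstract name keeps uncurry (e k) folded under reassociation. *)
have [c cE] : {c : forall k, hom (_ \ox _) _ | forall k, uncurry (e k) = c k}.
  by exists (fun k => uncurry (e k)).
have -> : (fun k => uncurry (e k)) = c by exact: functional_extensionality_dep.
have uncurryE X E (h : hom E (ihom C X)) k :
    uncurry_wedge (fun k => @weighted_map V self (Z k) C (G k) (e k) X \c h) k
    = uncurry h \c (idm E \tm c k).
  by rewrite uncurry_wedge_weighted_map cE.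
split=> [k l|Y d target_Y d_coeq].
  have /vwedge_coequalizes/(coequalizes_precomp (curry (lunit C)))/(_ k l)
    := (e_univ C target_C).1.
  rewrite -!uncurry_wedge_comp !uncurryE uncurryK -!compA -!tensm1l !lunit_natural => cab.
  by apply: iso_epi cab; exact: lunit_iso.
pose q k : hom (unitob V) (ihom (G k : V) (ihom (Z k : V) Y)) :=
  curry (curry (d k \c lunit _ \c assoc _ _ _)).
have qE k : uncurry_wedge q k = d k \c lunit _.
  by rewrite /uncurry_wedge !uncurryK -[LHS]compA associK compm1.
have q_wedge : vwedge (A := vop K) (F := G) (G := vrestrict Z Y) q.
  by apply/vwedge_coequalizes => k l; rewrite !qE -!compA !lunit_natural !compA d_coeq.
have [h [hq h_uniq]] := (e_univ Y target_Y).2 _ _ q_wedge.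
exists (uncurry h \c luniti _); split=> [k|h' h'c].
  have E : d k \c lunit _ = uncurry h \c (idm _ \tm c k).
    by rewrite -qE -uncurryE /uncurry_wedge hq.
  move: (uncurry h) E => u E; apply: (iso_epi (lunit_iso _)); rewrite E -!compA.
  by rewrite -lunit_natural (comp_whisker (lunitK _)) comp1m.
rewrite (h_uniq (curry (h' \c lunit _))) => [|k].
  by rewrite uncurryK -compA lunitiK compm1.
pose r k := @weighted_map V self (Z k) C (G k) (e k) Y \c curry (h' \c lunit C).
apply: (uncurry_wedge_inj (p := r)); rewrite uncurryE uncurryK qE.
by rewrite -compA lunit_natural compA h'c.
Qed.

End Coends.

(** * Weighted colimits of presentable objects *)

Section PresentableColimits.
Context {V : closed_symmetric_monoidal} (L : small).
Context {K : vcategory V}.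

Definition underlying (F : vfunctor K (pres (V := V) L)) : vfunctor K self :=
  @VFunctor V K self (fun k => sval (F k)) (fun k l => vfmap F k l) (vfmap1 F)
    (vfmapM F).

Context {G : vfunctor (vop K) self} {F : vfunctor K (pres (V := V) L)}.
Variable C : pres (V := V) L.

(** The enriched universal property gives that of the coend for presentable   *)
(** targets; G k (x) F k and K(l, k) (x) G k (x) F l are presentable, which     *)
(** extends it to all targets.                                                *)
Lemma presentable_weighted_coend
    (p : forall (X : pres L) k, hom (vhom C X) (ihom (G k : V) (vhom (F k) X))) :
  [set: nat] #<= [set: L] -> locally_presentable_base L V ->
  small_weight L G -> is_weighted_colimit (F := F) p ->
  is_coend (coend_left G (underlying F)) (coend_right G (underlying F))
    (fun k => uncurry (colimit_unit (F := F) p k)).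
Proof.
move=> L_inf V_base [KL Kpres Gpres] [p_univ p_nat].
pose e k := colimit_unit (F := F) p k.
have pE X : p X = fun k => weighted_map (e k) X.
  by apply: functional_extensionality_dep => k; exact: (weighted_map_yoneda (p_nat k)).
apply: (presentable_coend L_inf (lpb_locally_presentable V_base)) => //.
- by move=> k; apply: (lpb_tens V_base) => //; exact: (svalP (F k)).
- move=> k l; apply: (lpb_tens V_base) => //; last exact: (svalP (F l)).
  exact: (lpb_tens V_base).
- exact: (svalP C).
apply: (@vfunctor_hom_coend V K G (underlying F) _ (sval C) e (svalP C)) => X X_pres.
by have := p_univ (exist _ X X_pres); rewrite pE.
Qed.

Hypothesis I_pres : presentable L (unitob V).
Variable T : vfunctor (pres (V := V) L) self.
Notation unitP := (exist _ (unitob V) I_pres : pres (V := V) L).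
Notation t := (comparison I_pres T).

(** If T P is naturally P (x) T I, then T preserves the coend of G and F, as  *)
(** tensoring with T I does.                                                  *)
Lemma comparison_coend (e : forall k, hom (G k : V) (ihom (sval (F k)) (sval C))) :
  (forall P, is_iso (t P)) ->
  is_coend (coend_left G (underlying F)) (coend_right G (underlying F))
    (fun k => uncurry (e k)) ->
  is_coend (coend_left G (vfunctor_comp T F)) (coend_right G (vfunctor_comp T F))
    (fun k => uncurry (vfmap T (F k) C \c e k)).
Proof.
move=> t_iso /(tensm_coend (T unitP)) TI_coend.
pose r (k l : K) : hom _ ((vhom l k \ox (G k : V)) \ox (T (F l) : V)) :=
  (idm (vhom l k \ox (G k : V)) \tm t (F l)) \c assoc _ (sval (F l)) (T unitP : V).
pose n (k : K) : hom _ ((G k : V) \ox (T (F k) : V)) :=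
  (idm (G k : V) \tm t (F k)) \c assoc _ (sval (F k)) (T unitP : V).
apply: (@coend_iso V K _ (fun k => (G k : V) \ox (T (F k) : V)) _
  (fun k l => (vhom l k \ox (G k : V)) \ox (T (F l) : V)) _ _ _ _ _ _ _ _ r n (t C)
  _ _ _ _ _ _ TI_coend).
- move=> k l; apply: is_iso_comp; last exact: assoc_iso.
  by apply: tensm_iso; [exact: is_iso_id | exact: t_iso].
- move=> k; apply: is_iso_comp; last exact: assoc_iso.
  by apply: tensm_iso; [exact: is_iso_id | exact: t_iso].
- exact: t_iso.
- move=> k l; have actE : vaction (vfunctor_comp T F) l k \c (idm (vhom l k) \tm t (F l))
      = t (F k) \c (vaction (underlying F) l k \tm idm _) \c associ _ _ _.
    have -> : vaction (vfunctor_comp T F) l k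
        = vaction T (F l) (F k) \c (vfmap F l k \tm idm (T (F l) : V)).
      by rewrite !vactionE uncurry_comp.
    rewrite -[LHS]compA -tensm_lr (comparison_action I_pres T (vfmap F l k)).
    by rewrite vactionE.
  rewrite /r /n !coend_leftE -!compA.
  rewrite (comp_whisker (esym (tensm_lr (braid _ _) (t (F l))))).
  rewrite (tensm_rl (braid _ _) (t (F l))) -(tensm1 (G k : V) (vhom l k)) -!compA.
  rewrite (comp_whisker (assoc_natural _ _ (t (F l)))) -!compA.
  rewrite (comp_whisker (esym (tensm1l _ _ _))) actE.
  rewrite -(tensm1 (sval (F l))) -assoc_natural !tensm1l -!compA; congr (_ \c _).
  rewrite [in RHS]tensm1r [in RHS](comp_whisker (assoc_natural _ _ _)).
  rewrite -[in RHS]compA; congr (_ \c _).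
  rewrite [in RHS]tensm1r (comp_whisker (esym (pentagon _ _ _ _))) -!compA.
  by rewrite (comp_whisker (esym (tensm1l _ _ _))) assocK tensm1 comp1m.
- move=> k l; rewrite /r /n !coend_rightE -!compA.
  rewrite (comp_whisker (esym (tensm_lr _ _))) assoc_natural.
  by rewrite tensm1 (comp_whisker (esym (tensm_rl _ _))).
- move=> k; rewrite /n uncurry_comp -vactionE -!compA.
  rewrite (comp_whisker (esym (tensm_lr _ _))) compA comparison_action -!compA.
  by rewrite assocK compm1.
Qed.

End PresentableColimits.

(** * The essential image of the tensor embedding *)

Section UnitVCategory.
Context {V : closed_symmetric_monoidal}.

Lemma tens_lunit : idm (unitob V) \tm lunit (unitob V) = lunit (unitob V \ox unitob V).
Proof. by apply: (iso_mono (lunit_iso _)); rewrite lunit_natural. Qed.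

Lemma lunit_runit : lunit (unitob V) = runit (unitob V).
Proof.
apply: tensm_unitr_inj; rewrite -triangle tens_lunit.
by rewrite lunit_assoc.
Qed.

Program Definition unit_vcategory : vcategory V :=
  @VCategory V unit (fun _ _ => unitob V) (fun=> idm _) (fun _ _ _ => lunit _) _ _ _.
Next Obligation. by rewrite tensm1 compm1. Qed.
Next Obligation. by rewrite tensm1 compm1 lunit_runit. Qed.
Next Obligation. by rewrite tens_lunit -lunit_assoc compA. Qed.

Program Definition unit_diagram (A : vcategory V) (X : A) : vfunctor unit_vcategory A :=
  @VFunctor V unit_vcategory A (fun=> X) (fun _ _ => vid X) _ _.
Next Obligation. by rewrite compm1. Qed.
Next Obligation. by rewrite tensm_lr compA vcomp1l lunit_natural. Qed.

Program Definition unit_weight (X : V) : vfunctor (vop unit_vcategory) self :=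
  @VFunctor V (vop unit_vcategory) self (fun=> X) (fun _ _ => @vid V self X) _ _.
Next Obligation. by rewrite compm1. Qed.
Next Obligation.
rewrite lunit_braid -lunit_runit.
by rewrite tensm_lr compA (vcomp1l (v := self)) lunit_natural.
Qed.

(** Over the unit V-category the coend imposes no relation. *)
Lemma unit_coequalizes (X : V) (Z : vfunctor unit_vcategory self) :
  @coend_left V unit_vcategory (unit_weight X) Z tt tt
  = @coend_right V unit_vcategory (unit_weight X) Z tt tt.
Proof.
have idE (T : vfunctor unit_vcategory self) : vaction T tt tt = lunit (T tt : V).
  by rewrite -vaction_id /= tensm1 compm1.
rewrite coend_leftE coend_rightE idE.
have -> : vaction (unit_weight X) tt tt = lunit X.
  by rewrite vactionE uncurryK.
by rewrite triangle -tensm1r runit_braid.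
Qed.

End UnitVCategory.

Section EssentialImage.
Context {V : closed_symmetric_monoidal} (L : small).
Hypotheses (L_inf : [set: nat] #<= [set: L]) (V_base : locally_presentable_base L V).

Let I_pres : presentable L (unitob V) := lpb_unit V_base.
Notation unitP := (exist _ (unitob V) I_pres : pres (V := V) L).
Notation t := (comparison I_pres).

Lemma comparison_iso_cocontinuous (T : vfunctor (pres L) self) :
  (forall P, is_iso (t T P)) -> cocont (V := V) T.
Proof.
move=> t_iso K G F C p G_small p_colim.
exists (fun X k => weighted_map (vfmap T (F k) C \c colimit_unit p k) X).
split=> [|k]; last exact: weighted_map_unit.
apply: (@coend_weighted_colimit V K G (vfunctor_comp T F) (T C)
  (fun k => vfmap T (F k) C \c colimit_unit p k)).
apply: (comparison_coend t_iso); exact: presentable_weighted_coend.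
Qed.

(** P is the colimit of I weighted by P, which is a small weight as I and P   *)
(** are presentable.  Hence T P is the colimit of T I weighted by P, that is, *)
(** P (x) T I.                                                                *)
Lemma cocontinuous_comparison_iso (T : vfunctor (pres L) self) :
  cocont (V := V) T -> forall P, is_iso (t T P).
Proof.
move=> T_cocont P.
pose F := @unit_diagram V (pres L) unitP; pose G := unit_weight (sval P).
pose e (k : unit_vcategory (V := V)) : hom (sval P) (vhom unitP P) := unit_point (sval P).
have G_small : small_weight L G.
  split=> [|k l|k]; [exact: card_lt_finite | exact: I_pres | exact: (svalP P)].
have P_colim : is_weighted_colimit (G := G) (F := F) (C := P)
    (fun X k => weighted_map (e k) X).
  split=> [X|k]; last exact: weighted_map_natural.
  have is_wedge E q : @vwedge V (vop unit_vcategory) G (vrestrict F X) E q.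
    apply: (@vwedge_coequalizes V unit_vcategory G (underlying F) E (sval X) q).2.
    by move=> [] []; rewrite unit_coequalizes.
  have [v [vu uv]] := unit_point_iso (sval X).
  have pE E (h : hom E (vhom P X)) :
      uncurry (weighted_map (e tt) X \c h) = unit_point (sval X) \c uncurry h.
    rewrite uncurry_weighted_map tensm_rl compA.
    by rewrite /= -scomp_unit_point -compA.
  split=> [|E q _]; first exact: is_wedge.
  exists (curry (v \c uncurry (q tt))); split=> [[]|h hq].
    by apply: uncurry_inj; rewrite pE uncurryK compA uv comp1m.
  by apply: uncurry_inj; rewrite uncurryK -(hq tt) pE compA vu comp1m.
have [q [[q_univ q_nat] q_unit]] := T_cocont _ _ _ _ _ G_small P_colim.
pose e' (k : unit_vcategory (V := V)) := vfmap T unitP P \c e k.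
have qE X : q X = fun k => @weighted_map V self _ _ _ (e' k) X.
  apply: functional_extensionality_dep => k; rewrite /e'.
  rewrite -(weighted_map_unit (F := F) (G := G) e) -q_unit.
  exact: (weighted_map_yoneda (q_nat k)).
have T_coend : is_coend (coend_left G (vfunctor_comp T F))
    (coend_right G (vfunctor_comp T F)) (fun k => uncurry (e' k)).
  apply: vfunctor_hom_coend => // X _.
  by have := q_univ X; rewrite qE.
apply: iso_from_precomposition => Z g.
have tE k : uncurry (e' k) = t T P.
  by rewrite comparisonE vactionE -uncurry_comp.
have [|h [hg h_uniq]] := T_coend.2 Z (fun=> g) I.
  by move=> [] []; rewrite unit_coequalizes.
exists h; split=> [|k kg]; first by rewrite -(tE tt) hg.
by apply: h_uniq => j; rewrite tE.
Qed.

(** The symmetries in the action on T I (x) P cancel those in the map. *)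
Lemma tensor_approximation_natural (T : vfunctor (pres L) self) :
  vnatural (F := tensor_embedding_ob L (T unitP)) (G := T)
    (fun P => t T P \c braid (T unitP : V) (sval P)).
Proof.
apply/vnaturalP => P Q; rewrite [vaction (tensor_embedding_ob _ _) _ _]vactionE uncurryK.
rewrite /act -!compA (comp_whisker (braidK _ _)) comp1m.
rewrite tensm1l [RHS]compA (comparison_action I_pres T (idm (ihom (sval P) (sval Q)))).
by rewrite /uncurry tensm1 compm1 !compA.
Qed.

Definition tensor_approximation (T : vfunctor_category (pres L)) :
    hom (tensor_embedding L (T unitP : V)) T :=
  VTransformation (tensor_approximation_natural T).

Lemma tensor_approximation_iso (T : vfunctor_category (pres L)) :
  cocont T -> is_iso (tensor_approximation T).
Proof.
move=> /cocontinuous_comparison_iso t_iso; apply: vtransformation_iso => P.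
by apply: is_iso_comp; [exact: t_iso | exact: braid_iso].
Qed.

Lemma tensor_embedding_cocontinuous (X : V) : cocont (V := V) (tensor_embedding L X).
Proof. by apply: comparison_iso_cocontinuous => P; exact: comparison_tensor_iso. Qed.

(** The comparison is natural in T and invertible for tensor functors. *)
Lemma essential_imageP (T : vfunctor_category (pres L)) :
  essential_image (tensor_embedding (V := V) L) T <-> cocont (V := V) T.
Proof.
split=> [[X [a [b [ba ab]]]]|T_cocont]; last first.
  by exists (T unitP : V), (tensor_approximation T); exact: tensor_approximation_iso.
apply: comparison_iso_cocontinuous => P.
have a_iso Q : is_iso (vt a Q).
  exists (vt b Q).
  by split; [move/(congr1 (fun c => vt c Q)): ba | move/(congr1 (fun c => vt c Q)): ab].
apply: (is_iso_cancel_r (f := idm (sval P) \tm vt a unitP)).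
  by apply: tensm_iso; [exact: is_iso_id | exact: a_iso].
rewrite -comparison_natural; apply: is_iso_comp; first exact: a_iso.
exact: comparison_tensor_iso.
Qed.

Definition unit_evaluation :
    functor (full_subcategory (C := vfunctor_category (pres (V := V) L)) (@cocont V L)) V :=
  @Functor (full_subcategory (C := vfunctor_category (pres (V := V) L)) (@cocont V L)) V
    (fun T => sval T unitP) (fun T T' a => vt a unitP) (fun=> erefl)
    (fun _ _ _ _ _ => erefl).

Lemma tensor_embedding_equivalence
    (Theta_cocont : forall X : V, cocont (V := V) (tensor_embedding L X)) :
  is_equivalence (corestrict Theta_cocont).
Proof.
exists unit_evaluation; split.
  exists (fun X => runit X); split=> [X Y f|X]; last exact: runit_iso.
  by rewrite /= runit_natural.
exists (fun T => tensor_approximation (sval T)); split=> [T T' a|T]; last first.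
  have [b [ba ab]] := tensor_approximation_iso (svalP T).
  by exists b.
apply: vtransformation_eq => P /=.
rewrite -[LHS]compA braid_natural !compA; congr (_ \c _).
by rewrite comparison_natural.
Qed.

Lemma tensor_embedding_additive
    (Theta_cocont : forall X : V, cocont (V := V) (tensor_embedding L X)) :
  additive_functor (corestrict Theta_cocont).
Proof.
apply: equivalence_additive => [X Y f g|X Y h|T].
- exact: (tensor_embedding_faithful I_pres).
- exact: (tensor_embedding_full I_pres).
exists (sval T unitP); have [b [ba ab]] := tensor_approximation_iso (svalP T).
by exists (tensor_approximation (sval T)), b.
Qed.

End EssentialImage.

(** * Geometric purity *)

Section Purity.
Context {V : closed_symmetric_monoidal}.

Definition tens_functor (X : V) : functor V V :=
  @Functor V V (tens X) (fun Y Z f => idm X \tm f) (fun Y => tensm1 X Y)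
    (fun _ _ _ g f => tensm1l X g f).

Lemma tens_functor_colimit (X : V) (J : category) (D : functor J V) (W : V)
    (i : forall j, hom (D j) W) :
  is_colimit i ->
  is_colimit (D := comp_functor (tens_functor X) D) (fun j => idm X \tm i j).
Proof.
move=> [i_cocone i_univ]; split=> [j k u|Y y y_cocone].
  by rewrite /= -tensm1l i_cocone.
have [|h [hi h_uniq]] := i_univ (ihom X Y) (fun j => curry (y j \c braid (D j) X)).
  move=> j k u; apply: uncurry_inj; rewrite uncurry_comp !uncurryK -compA braid_natural.
  by rewrite compA -(y_cocone _ _ u).
exists (uncurry h \c braid X W); split=> [j|h' h'i].
  rewrite -compA braid_natural compA -uncurry_comp hi uncurryK.
  by rewrite -compA braidK compm1.
rewrite (h_uniq (curry (h' \c braid W X))) => [|j].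
  by rewrite uncurryK -compA braidK compm1.
apply: uncurry_inj; rewrite uncurry_comp !uncurryK -compA braid_natural compA.
by rewrite h'i.
Qed.

(** Every W is a directed colimit of presentable objects, and a directed      *)
(** colimit of short exact sequences is short exact.                          *)
Lemma pure_on_presentable (L : small) (X Y Z : V) (f : hom X Y) (g : hom Y Z) :
  [set: nat] #<= [set: L] -> locally_presentable L V -> exact_filtered_colimits V ->
  (forall P, presentable L P -> short_exact (f \tm idm P) (g \tm idm P)) ->
  forall W : V, short_exact (f \tm idm W) (g \tm idm W).
Proof.
move=> L_inf [_ [S [P [P_pres P_gen]]]] AB5 fg W.
have [J [D [i [J_dir DP i_colim]]]] := P_gen W.
have D_pres j : presentable L (D j).
  have [s [u [v [vu uv]]]] := DP j; apply: presentable_iso (P_pres s).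
  by exists v, u.
have colim U := tens_functor_colimit U i_colim.
pose tensD U := comp_functor (tens_functor U) D.
apply: (AB5 _ (tensD X) (tensD Y) (tensD Z) (fun j => f \tm idm (D j))
  (fun j => g \tm idm (D j)) _ _ _ _ _ _ _ _
  (small_poset_category J) (directed_filtered L_inf J_dir) _ _ _ (colim X) (colim Y)
  (colim Z)).
- by move=> j k u /=; rewrite -tensm_lr -tensm_rl.
- by move=> j k u /=; rewrite -tensm_lr -tensm_rl.
- by move=> j; exact: fg.
- by move=> j; rewrite -tensm_lr -tensm_rl.
- by move=> j; rewrite -tensm_lr -tensm_rl.
Qed.

(** Evaluation at P preserves kernels, full faithfulness reflects the exact   *)
(** sequence to V, and tensoring preserves cokernels; this gives exactness    *)
(** after tensoring with presentable objects.                                 *)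
Lemma geometrically_pureP (L : small) (X Y Z : V) (f : hom X Y) (g : hom Y Z) :
  [set: nat] #<= [set: L] -> locally_presentable_base L V -> grothendieck_category V ->
  geometrically_pure f g <->
  short_exact (fmap (tensor_embedding L) f) (fmap (tensor_embedding L) g).
Proof.
move=> L_inf V_base V_groth.
have [Z0 Z0z] := abelian_zero (grothendieck_abelian V_groth).
have I_pres := lpb_unit V_base.
split=> [[_ fg]|Theta_fg].
  split; first by apply: (componentwise_kernel Z0z) => P; exact: (fg _).1.
  by apply: (componentwise_cokernel Z0z) => P; exact: (fg _).2.
have Theta_Z0 : is_zero_object (tensor_embedding L Z0).
  apply: (zero_object_iso (@vzeroP _ _ Z0z (pres L))).
  have [p _] := (@vzeroP _ _ Z0z (pres L) (tensor_embedding L Z0)).1; exists p.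
  apply: vtransformation_iso => P.
  have [q _] := (Z0z (Z0 \ox sval P)).2; exists q; split; last exact: zero_object_to.
  by apply: zero_object_to; exact: tens_zero_object.
have [f_kernel g_cokernel] : short_exact f g.
  have faithful := @tensor_embedding_faithful V L I_pres.
  have full := @tensor_embedding_full V L I_pres.
  split; first exact: (reflect_kernel faithful full Z0z Theta_Z0 Theta_fg.1).
  exact: (reflect_cokernel faithful full Z0z Theta_Z0 Theta_fg.2).
split=> //; apply: (pure_on_presentable L_inf (lpb_locally_presentable V_base)).
  exact: grothendieck_exact.
move=> P P_pres; split; last exact: (cokernel_tensm Z0z).
exact: (kernel_component Z0z Theta_fg.1 (exist _ P P_pres)).
Qed.

End Purity.

(** * The tensor embedding as an equivalence of exact categories *)

Theorem theoremC (V : grothendieck_cosmos) (L : small)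
    (L_regular : regular_cardinal L) (V_base : locally_presentable_base L V) :
  tensor_embedding_fully_faithful (V := V) L /\
  (forall T : vfunctor_category (pres (V := V) L),
    essential_image (tensor_embedding L) T <-> cocont (V := V) T) /\
  exists Theta_cocont : forall X : V, cocont (tensor_embedding L X),
    exact_equivalence (@geometrically_pure V) (induced_exact_structure (P := @cocont V L))
      (corestrict Theta_cocont).
Proof.
have L_inf := L_regular.1; split; last split.
- exact: tensor_embedding_is_fully_faithful (lpb_unit V_base).
- by move=> T; exact: essential_imageP.
exists (tensor_embedding_cocontinuous L_inf V_base); split.
- exact: tensor_embedding_equivalence.
- exact: tensor_embedding_additive.
- move=> X Y Z f g; apply: geometrically_pureP => //.
  exact: cosmos_grothendieck.
Qed.
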